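(* Let $\Omega\subset\mathbb{R}^d$ be a bounded convex open set with $\lambda(\Omega)=1$. For each $n\in\mathbb{N}\cup\{\infty\}$ let $\nu_n$ be a pure point probability measure on $\mathbb{R}^d$. Let $\varphi_n$ be the convex potential associated with $\nu_n$, i.e., a convex function on $\mathbb{R}^d$ (with values in $\mathbb{R}\cup\{\infty\}$, finite on $\Omega$) whose a.e.-defined gradient on $\Omega$ pushes $\lambda\llcorner\Omega$ forward to $\nu_n$, and let $A^n=\{x\in\Omega:\varphi_n\text{ is affine on a neighborhood of }x\}$. Let $X^n_t=\mathrm{id}+t\nabla\varphi_n$ be the corresponding flow map, and let $\kappa^n_t=\lambda\llcorner X^n_t(A^n)$. If $\nu_n\to\nu_\infty$ weak-$*$ in $\mathcal{M}(\mathbb{R}^d)$ as $n\to\infty$, then $\kappa^n_t\to\kappa^\infty_t$ weak-$*$ in $\mathcal{M}(\mathbb{R}^d)$ for each $t>0$.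
   Context: $\lambda$ is Lebesgue measure on $\mathbb{R}^d$, and $\lambda\llcorner S$ denotes its restriction to $S$. $\mathcal{M}(\mathbb{R}^d)=C_0(\mathbb{R}^d)^*$ is the space of finite signed Radon measures on $\mathbb{R}^d$, with weak-$*$ convergence tested against continuous functions vanishing at infinity. A pure point probability measure has the form $\nu=\sum_i m_i\delta_{v_i}$ with countably many distinct $v_i\in\mathbb{R}^d$, $m_i>0$, $\sum_i m_i=1$. By a theorem of McCann, for each such $\nu_n$ a convex function $\varphi_n$ with $(\nabla\varphi_n)_\sharp(\lambda\llcorner\Omega)=\nu_n$ exists and its gradient is uniquely determined a.e. in $\Omega$; the set $A^n$ is open with full measure in $\Omega$. *)

(* Defs.v *)
From HB Require Import structures.
From mathcomp Require Import all_boot all_order all_algebra.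
From mathcomp Require Import all_classical all_reals all_analysis.
From mathcomp Require Import measurable_realfun.
Set Implicit Arguments.
Unset Strict Implicit.
Unset Printing Implicit Defensive.
Import Order.TTheory GRing.Theory Num.Theory.
Import numFieldNormedType.Exports.
Local Open Scope classical_set_scope.
Local Open Scope ring_scope.

(* Borel sigma-algebra. *)
HB.instance Definition _ (R : realType) (m n : nat) :=
  @isMeasurable.Build (sigma_display (@open 'M[R]_(m, n))) 'M[R]_(m, n)
    <<s @open 'M[R]_(m, n) >>
    (@sigma_algebra0 _ setT (@open 'M[R]_(m, n)))
    (@sigma_algebraC _ (@open 'M[R]_(m, n)))
    (@sigma_algebra_bigcup _ setT (@open 'M[R]_(m, n))).

Section borel.
Context {R : realType}.

Lemma open_measurable_mx m n (U : set 'M[R]_(m, n)) : open U -> measurable U.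
Proof. exact: sub_sigma_algebra. Qed.

Lemma measurable_fun_mx d (T : measurableType d) m n (f : T -> 'M[R]_(m, n)) :
  (forall U, open U -> measurable (f @^-1` U)) -> measurable_fun setT f.
Proof.
move=> mf; apply: (@measurability _ _ _ _ setT f (@open 'M[R]_(m, n))) => //.
by move=> _ [B oB <-]; rewrite setTI; exact: mf.
Qed.

Lemma measurable_coord m n (i : 'I_m) (j : 'I_n) :
  measurable_fun setT (fun x : 'M[R]_(m, n) => x i j : measurableTypeR R).
Proof.
apply: (measurability _ (RGenOpens.measurableE R)) => //.
move=> _ [_ [a [b ->] <-]]; rewrite setTI; apply: open_measurable_mx.
by move/continuousP: (@coord_continuous R m n i j); apply; exact: interval_open.
Qed.

Lemma open_bigcup_rat_ball m n (U : set 'M[R]_(m, n)) : open U ->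
  U = \bigcup_(k : 'M[rat]_(m, n) * rat)
        [set x | ball (map_mx ratr k.1 : 'M[R]_(m, n)) (ratr k.2) x /\
                 ball (map_mx ratr k.1 : 'M[R]_(m, n)) (ratr k.2) `<=` U].
Proof.
move=> oU; apply/seteqP; split => [x Ux|x [k _ [kx kU]]]; last exact: kU.
have /nbhs_ballP[e /= e0 eU] := open_nbhs_nbhs (conj oU Ux).
have /rat_in_itvoo[r] : 0 < e / 2 by rewrite divr_gt0.
rewrite in_itv/= => /andP[r0 re].
have qP i j : exists q : rat, `|x i j - ratr q| < ratr r :> R.
  have /rat_in_itvoo[q] : x i j - ratr r < x i j + ratr r.
    by rewrite ltrD2l gtrN.
  by rewrite in_itv/= -ltr_distl => xq; exists q; rewrite distrC.
pose q := \matrix_(i, j) projT1 (cid (qP i j)).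
have rx : ball (map_mx ratr q : 'M[R]_(m, n)) (ratr r) x.
  split => // i j; rewrite !mxE /ball/= distrC.
  by case: cid.
exists (q, r) => //; split => //= y ry.
apply: eU; apply: le_ball (ball_triangle (ball_sym rx) ry).
by rewrite [leRHS]splitr lerD// ltW.
Qed.

(* The point of R^(d+1) with first coordinate p.1 and remaining ones p.2. *)
Definition row_cons d (p : measurableTypeR R * 'rV[R]_d) : 'rV[R]_d.+1 :=
  row_mx (p.1%:M : 'rV[R]_1) p.2.

Lemma row_cons0 d p : @row_cons d p ord0 ord0 = p.1.
Proof.
rewrite /row_cons (_ : ord0 = lshift d (ord0 : 'I_1)); last exact: val_inj.
by rewrite (row_mxEl (p.1%:M : 'rV_1)) mxE.
Qed.

Lemma row_consS d p j : @row_cons d p ord0 (lift ord0 j) = p.2 ord0 j.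
Proof.
rewrite /row_cons (_ : lift ord0 j = rshift 1 j); last exact: val_inj.
by rewrite (row_mxEr (p.1%:M : 'rV_1)).
Qed.

Lemma measurable_row_cons d : measurable_fun setT (@row_cons d).
Proof.
apply: measurable_fun_mx => U /open_bigcup_rat_ball ->.
rewrite preimage_bigcup; apply: countable_bigcupT_measurable => // -[q r] /=.
have [qU|qU] := pselect (ball (map_mx ratr q : 'rV[R]_d.+1) (ratr r) `<=` U);
  last first.
  rewrite (_ : _ @^-1` _ = set0)//.
  by apply/seteqP; split => // x [].
rewrite (_ : _ @^-1` _ = (ball (ratr (q ord0 ord0) : R) (ratr r)) `*`
   (ball (map_mx ratr (\row_j q ord0 (lift ord0 j)) : 'rV[R]_d) (ratr r))).
  apply: measurableX; first exact: measurable_ball.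
  by apply: open_measurable_mx; exact: ball_open.
apply/seteqP; split => [[a x] /= [[r0 ax] _]|[a x] /= [ax [r0 bx]]].
  split; first by have := ax ord0 ord0; rewrite row_cons0 mxE.
  split => // i j; have := ax ord0 (lift ord0 j).
  by rewrite row_consS !mxE (ord1 i).
split => //; split => // i j; rewrite (ord1 i).
have [j' ->|->] := unliftP ord0 j.
  by rewrite row_consS mxE; have := bx ord0 j'; rewrite !mxE.
by rewrite row_cons0 mxE.
Qed.

Definition row_uncons d (x : 'rV[R]_d.+1) : measurableTypeR R * 'rV[R]_d :=
  (x ord0 ord0, \row_j x ord0 (lift ord0 j)).

Lemma row_consK d : cancel (@row_cons d) (@row_uncons d).
Proof.
move=> [a x]; rewrite /row_uncons row_cons0/=; congr pair.
by apply/rowP => j; rewrite mxE row_consS.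
Qed.

Lemma row_unconsK d : cancel (@row_uncons d) (@row_cons d).
Proof.
move=> x; apply/rowP => j; have [j' ->|->] := unliftP ord0 j.
  by rewrite row_consS mxE.
by rewrite row_cons0.
Qed.

Lemma measurable_row_uncons d : measurable_fun setT (@row_uncons d).
Proof.
apply/measurable_fun_pair => /=; first exact: measurable_coord.
apply: measurable_fun_mx => U oU; apply: open_measurable_mx.
suff /continuousP : continuous (fun x : 'rV[R]_d.+1 =>
  \row_(j < d) x ord0 (lift ord0 j)) by exact.
move=> x V /nbhs_ballP[e /= e0 eV]; apply/nbhs_ballP.
exists e => //= y [_ xy]; apply: eV.
by split => // i j; rewrite !mxE; exact: xy.
Qed.

End borel.

Section lebesgue_succ.
Local Open Scope ereal_scope.
Context {R : realType} {d : nat}.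
Variable m : {sigma_finite_measure set 'rV[R]_d -> \bar R}.

Definition lebesgue_succ : set 'rV[R]_d.+1 -> \bar R :=
  pushforward (lebesgue_measure \x m) (@row_cons R d).

Let lebesgue_succ0 : lebesgue_succ set0 = 0.
Proof. by rewrite /lebesgue_succ /pushforward preimage_set0 measure0. Qed.

Let lebesgue_succ_ge0 A : 0 <= lebesgue_succ A.
Proof. by rewrite /lebesgue_succ /pushforward; exact: measure_ge0. Qed.

Let lebesgue_succ_sigma_additive : semi_sigma_additive lebesgue_succ.
Proof.
have mf := @measurable_row_cons R d.
exact: measure_semi_sigma_additive.
Qed.

HB.instance Definition _ := isMeasure.Build _ _ _ lebesgue_succ
  lebesgue_succ0 lebesgue_succ_ge0 lebesgue_succ_sigma_additive.

Let lebesgue_succ_sigma_finite : sigma_finite setT lebesgue_succ.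
Proof.
have /sigma_finiteP[F [FT ndF Foo]] := sigma_finiteT (@lebesgue_measure R).
have /sigma_finiteP[G [GT ndG Goo]] := sigma_finiteT m.
exists (fun k => @row_uncons R d @^-1` (F k `*` G k)).
  apply/esym/seteqP; split => // x _.
  have [n _ Fx] : (\bigcup_i F i) (row_uncons x).1 by rewrite -FT.
  have [k _ Gx] : (\bigcup_i G i) (row_uncons x).2 by rewrite -GT.
  exists (maxn n k) => //; split.
    by have /subsetPset := ndF _ _ (leq_maxl n k); apply.
  by have /subsetPset := ndG _ _ (leq_maxr n k); apply.
move=> k; have [mF Fk] := Foo k; have [mG Gk] := Goo k; split.
  rewrite -[X in measurable X]setTI; apply: measurable_row_uncons => //.
  exact: measurableX.
rewrite /lebesgue_succ /pushforward -comp_preimage.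
rewrite (_ : _ \o _ = id); last by apply/funext => p /=; rewrite row_consK.
by rewrite preimage_id product_measure1E// lte_mul_pinfty// ge0_fin_numE.
Qed.

HB.instance Definition _ := Measure_isSigmaFinite.Build _ _ _ lebesgue_succ
  lebesgue_succ_sigma_finite.

End lebesgue_succ.

(* d-fold product of the Lebesgue measure of the line; see lebesgue_rV_box for
   the value on boxes. *)
Fixpoint lebesgue_rV (R : realType) (d : nat) :
    {sigma_finite_measure set 'rV[R]_d -> \bar R} :=
  match d with
  | 0%N => \d_(0 : 'rV[R]_0)
  | d'.+1 => lebesgue_succ (lebesgue_rV R d')
  end.

Definition box {R : realType} {d} (a b : 'rV[R]_d) : set 'rV[R]_d :=
  [set x | forall i, a ord0 i <= x ord0 i <= b ord0 i].

Lemma measurable_box (R : realType) d (a b : 'rV[R]_d) : measurable (box a b).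
Proof.
rewrite (_ : box a b = \bigcap_(i in [set: 'I_d])
  ((fun x : 'rV[R]_d => x ord0 i : measurableTypeR R) @^-1`
    `[a ord0 i, b ord0 i]%classic)).
  apply: fin_bigcap_measurable => // i _.
  by rewrite -[X in measurable X]setTI; exact: measurable_coord.
apply/seteqP; split => [x abx i _|x abx i] /=.
  by rewrite in_itv/=.
by have := abx i Logic.I; rewrite /= in_itv.
Qed.

Lemma lebesgue_rV_box (R : realType) d (a b : 'rV[R]_d) :
  (forall i, a ord0 i <= b ord0 i) ->
  lebesgue_rV R d (box a b) = (\prod_i (b ord0 i - a ord0 i))%:E.
Proof.
elim: d => [|d IH] in a b *.
  by move=> _; rewrite big_ord0 /= diracE mem_set// => -[].
move=> ab; rewrite big_ord_recl /= /lebesgue_succ /pushforward.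
set a' := \row_i a ord0 (lift ord0 i).
set b' := \row_i b ord0 (lift ord0 i).
rewrite (_ : _ @^-1` _ = `[a ord0 ord0, b ord0 ord0]%classic `*` box a' b').
  rewrite product_measure1E//; last exact: measurable_box.
  rewrite IH; last by move=> i; rewrite !mxE.
  rewrite EFinM; congr (_ * _)%E.
    rewrite [LHS]lebesgue_measure_itv/= lte_fin -EFinB.
    by case: ltgtP (ab ord0) => // -> _; rewrite subrr.
  by congr EFin; apply: eq_bigr => i _; rewrite !mxE.
apply/seteqP; split => [[r x] /= abx|[r x] /= [rab abx] i].
  split; first by have := abx ord0; rewrite row_cons0 in_itv.
  by move=> i; have := abx (lift ord0 i); rewrite row_consS !mxE.
have [j ->|->] := unliftP ord0 i.
  by have := abx j; rewrite row_consS !mxE.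
by move: rab; rewrite row_cons0 in_itv.
Qed.

Section defs.
Context {R : realType} {d : nat}.
Implicit Types (x y v : 'rV[R]_d) (Omega : set 'rV[R]_d) (phi : 'rV[R]_d -> \bar R).

Definition dotrV v x : R := \sum_i v ord0 i * x ord0 i.

(* Total function, meaningful only where phi is finite near x and
   differentiable at x. *)
Definition gradient phi x : 'rV[R]_d :=
  \row_i 'D_(delta_mx ord0 i) (fine \o phi) x.

Definition affine_locus Omega phi : set 'rV[R]_d :=
  [set x | Omega x /\ exists v (c : R),
     \forall y \near x, phi y = (dotrV v y + c)%:E].

Definition flow_map phi (t : R) x : 'rV[R]_d := x + t *: gradient phi x.

Lemma dotrVD v x y : dotrV v (x + y) = dotrV v x + dotrV v y.
Proof.
by rewrite /dotrV -big_split; apply: eq_bigr => i _; rewrite mxE mulrDr.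
Qed.

Lemma dotrV_delta v (h : R) i :
  dotrV v (h *: delta_mx ord0 i) = h * v ord0 i.
Proof.
rewrite /dotrV (bigD1 i)//= big1 => [|j ji].
  by rewrite addr0 !mxE !eqxx mulr1 mulrC.
by rewrite !mxE (negbTE ji) andbF !mulr0.
Qed.

Lemma gradient_affine phi v c x :
  (\forall y \near x, phi y = (dotrV v y + c)%:E) -> gradient phi x = v.
Proof.
move=> phix; apply/rowP => i; rewrite mxE.
rewrite (@near_eq_derive _ _ _ (fine \o phi) (fun y => dotrV v y + c)); last first.
  by apply: filterS phix => y /= ->.
apply: cvg_lim => //; apply: (cvg_trans _ (cvg_cst (v ord0 i))).
apply: near_eq_cvg; near=> h.
rewrite /= dotrVD dotrV_delta opprD addrACA addrK.
rewrite subrr addr0 [RHS]mulKf//; near: h; exact: nbhs_dnbhs_neq.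
Unshelve. all: try by end_near. exact: dnbhs_filter. Qed.

Lemma open_flow_image Omega phi t : open Omega ->
  open (flow_map phi t @` affine_locus Omega phi).
Proof.
move=> oO; rewrite openE => _ [x [Ox [v [c phix]]] <-].
have /nbhs_ballP[e /= e0 He] : nbhs x [set y | Omega y /\
    \forall z \near y, phi z = (dotrV v z + c)%:E].
  apply: filterI; first exact: open_nbhs_nbhs.
  exact: (nbhs_interior phix).
apply/nbhs_ballP; exists e => //= z; rewrite /flow_map.
rewrite (gradient_affine phix) => xz.
have zx : ball x e (z - t *: v).
  move: xz; rewrite !mx_norm_ball /ball_/=.
  by rewrite opprB addrA.
have [Oz phiz] := He _ zx.
exists (z - t *: v); first by split => //; exists v, c.
by rewrite (gradient_affine phiz) subrK.
Qed.

(* The set of affine points is open and the flow map is locally a translation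
   there, so the restriction below is to a Borel set. *)
Definition kappa Omega (oOmega : open Omega) phi t :
    {measure set 'rV[R]_d -> \bar R} :=
  mrestr (lebesgue_rV R d)
    (open_measurable_mx (open_flow_image (phi := phi) (t := t) oOmega)).

Definition econvex phi :=
  forall x y (s : R), 0 <= s <= 1 ->
    (phi (s *: x + (1 - s) *: y)%R
      <= s%:E * phi x + (1 - s)%:E * phi y)%E.

(* The almost everywhere defined gradient of phi is represented by a Borel
   map T that agrees with it at almost every point of Omega. *)
Definition convex_potential Omega (oOmega : open Omega)
    (nu : {measure set 'rV[R]_d -> \bar R}) phi :=
  [/\ forall x, phi x != -oo%E,
      econvex phi,
      forall x, Omega x -> phi x \is a fin_num &
      exists T : 'rV[R]_d -> 'rV[R]_d,
        [/\ measurable_fun setT T,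
            {ae lebesgue_rV R d, forall x, Omega x ->
               differentiable (fine \o phi) x /\ T x = gradient phi x} &
            forall B, measurable B ->
              pushforward
                (mrestr (lebesgue_rV R d) (open_measurable_mx oOmega)) T B
              = nu B]].

Definition pure_point (nu : {measure set 'rV[R]_d -> \bar R}) :=
  exists (I : set nat) (m : nat -> R) (v : nat -> 'rV[R]_d),
    [/\ forall i, I i -> 0 < m i,
        set_inj I v,
        (\esum_(i in I) (m i)%:E = 1)%E &
        forall B, measurable B ->
          (nu B = \esum_(i in I) ((m i)%:E * \d_(v i) B))%E].

Definition vanishes_at_infinity (f : 'rV[R]_d -> R) :=
  forall e : R, 0 < e ->
    exists2 K : set 'rV[R]_d, compact K & forall x, ~ K x -> `|f x| < e.

(* Finiteness is membership in the space of finite Radon measures: on R^d every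
   finite Borel measure is Radon. *)
Definition weak_star_cvg (mu_ : nat -> {measure set 'rV[R]_d -> \bar R})
    (mu : {measure set 'rV[R]_d -> \bar R}) :=
  [/\ forall n, fin_num_fun (mu_ n),
      fin_num_fun mu &
      forall f : 'rV[R]_d -> R, continuous f -> vanishes_at_infinity f ->
        (\int[mu_ n]_x (f x)%:E @[n --> \oo] --> \int[mu]_x (f x)%:E)%E].

End defs.

(* Main.v *)
(* The maps T_n = grad phi_n are shown to converge to T = grad phi_oo in measure
   on Omega, without compactness of the potentials. Since almost all of the mass
   of the limit sits in finitely many cells A_l = {T = v_l}, it is enough to see
   that the sets B_l = {|T_n - v_l| < r}, whose measures are asymptotically at
   least those of the A_l, do not leak out of the A_l. If B_l meets A_k draw an
   edge l -> k. Along a cycle of edges, the subgradient inequalities of phi_n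
   and phi_oo force every point of B_l to satisfy the affine equation of A_l up
   to O(r), which leaves little room outside A_l; edges lying on no cycle carry
   little mass, since each B_l weighs about as much as A_l.
   On each cell phi_n is affine, cells are convex, hence almost every point of a
   cell is interior; the flow map is an injective translation there, so that
   kappa_t is the image of Lebesgue measure on Omega under id + t T_n. *)
Require Import Defs.
From HB Require Import structures.
From mathcomp Require Import all_boot all_order all_algebra.
From mathcomp Require Import all_classical all_reals all_analysis.
From mathcomp Require Import measurable_realfun lra ring.
Set Implicit Arguments.
Unset Strict Implicit.
Unset Printing Implicit Defensive.
Import Order.TTheory GRing.Theory Num.Theory.
Import numFieldNormedType.Exports.
Local Open Scope classical_set_scope.
Local Open Scope ring_scope.

(** * Pushforward measures and measurability of vector-valued maps *)

Definition pushforward_by (R : realFieldType) d1 d2 (T1 : measurableType d1)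
    (T2 : measurableType d2) (mu : {measure set T1 -> \bar R}) (f : T1 -> T2)
    (mf : measurable_fun setT f) : {measure set T2 -> \bar R} :=
  measure_function_pushforward__canonical__measure_function_Measure mu mf.

(** An open set is a countable union of balls with rational data, and a ball of the sup norm is a
    product of intervals. *)
Lemma measurable_fun_rV (R : realType) dT (T : measurableType dT) d
    (f : T -> 'rV[R]_d) :
  (forall i, measurable_fun setT (fun x => f x ord0 i : measurableTypeR R)) ->
  measurable_fun setT f.
Proof.
move=> mf; apply: measurable_fun_mx => U /open_bigcup_rat_ball ->.
rewrite preimage_bigcup; apply: countable_bigcupT_measurable => // -[q r] /=.
have [qU|qU] := pselect (ball (map_mx ratr q : 'rV[R]_d) (ratr r) `<=` U);
  last first.
  rewrite (_ : _ @^-1` _ = set0)//.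
  by apply/seteqP; split => // x [].
(* In dimension 0 the coordinates do not detect a nonpositive radius, so the empty ball is split
   off. *)
have [r0|r0] := ltP (0 : R) (ratr r); last first.
  rewrite (_ : _ @^-1` _ = set0)//.
  by apply/seteqP; split => // x [[/=]]; rewrite ltNge r0.
rewrite (_ : _ @^-1` _ = \bigcap_(i in [set: 'I_d])
   ((fun x => f x ord0 i : measurableTypeR R) @^-1`
      ball (ratr (q ord0 i) : R) (ratr r))).
  apply: fin_bigcap_measurable => // i _.
  rewrite -[X in measurable X]setTI; apply: mf => //.
  exact: measurable_ball.
apply/seteqP; split => [x [[_ qx] _] i _|x qx]; first by have := qx ord0 i; rewrite mxE.
split => //; split => // i j; rewrite (ord1 i) mxE; exact: qx.
Qed.

Lemma continuous_measurable_rV (R : realType) m n (f : 'M[R]_(m, n) -> R) :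
  continuous f -> measurable_fun setT (f : _ -> measurableTypeR R).
Proof.
move=> cf; apply: (measurability _ (RGenOpens.measurableE R)) => //.
move=> _ [_ [a [b ->] <-]]; rewrite setTI; apply: open_measurable_mx.
by move/continuousP: cf; apply; exact: interval_open.
Qed.

(** * Translation invariance of Lebesgue measure *)

Section translation.
Local Open Scope ereal_scope.
Context {R : realType}.

Lemma measurable_addr (a : R) :
  measurable_fun setT (fun x : measurableTypeR R => (x + a)%R : measurableTypeR R).
Proof. by apply: measurable_funD => //; exact: measurable_id. Qed.

Lemma lebesgue_measure_addr (a : R) (B : set (measurableTypeR R)) :
  measurable B ->
  lebesgue_measure ((fun x : measurableTypeR R => (x + a)%R) @^-1` B)
  = lebesgue_measure B.
Proof.
move=> mB; apply/esym.
apply: (@lebesgue_measure_unique R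
  (pushforward_by lebesgue_measure (measurable_addr a))) => //.
move=> _ [[b c] _ <-] /=.
rewrite /pushforward (_ : _ @^-1` _ = `]b - a, c - a]%classic)%R; last first.
  by apply/seteqP; split => x; rewrite /= !in_itv/= -lerBrDr -ltrBlDr.
rewrite !lebesgue_measure_itv/= !lte_fin ltrD2r; case: ifP => // _.
by rewrite -!EFinD opprB addrA subrK.
Qed.

Lemma measurable_rV_addr d (v : 'rV[R]_d) :
  measurable_fun setT (fun x : 'rV[R]_d => (x + v)%R).
Proof.
apply: measurable_fun_rV => i.
under eq_fun do rewrite mxE.
apply: measurable_funD; [exact: measurable_coord | exact: measurable_cst].
Qed.

(** By induction on the dimension: in the coordinates of [row_uncons] the translation is a product
    of translations, so the translated product measure agrees with the original one on rectangles,
    which determine it. *)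
Lemma lebesgue_rV_addr d (v : 'rV[R]_d) (B : set 'rV[R]_d) :
  measurable B ->
  lebesgue_rV R d ((fun x => (x + v)%R) @^-1` B) = lebesgue_rV R d B.
Proof.
elim: d => [|d IH] in v B *.
  move=> mB; congr (lebesgue_rV R 0 _); apply/seteqP.
  by split => x; rewrite /= (_ : (x + v)%R = x)//; apply/rowP => -[].
move=> mB.
have mf : measurable_fun setT (fun p : measurableTypeR R * 'rV[R]_d =>
    row_uncons (row_cons p + v)%R).
  exact: (measurableT_comp (@measurable_row_uncons R d)
    (measurableT_comp (measurable_rV_addr v) (@measurable_row_cons R d))).
pose m' := pushforward_by (lebesgue_measure \x lebesgue_rV R d) mf.
have mC : measurable (@row_cons R d @^-1` B).
  by rewrite -[X in measurable X]setTI; exact: measurable_row_cons.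
transitivity (m' (@row_cons R d @^-1` B)).
  rewrite /= /lebesgue_succ /m' /= /pushforward.
  by congr (_ _); apply/seteqP; split => p /=; rewrite row_unconsK.
apply/esym; apply: product_measure_unique => // A C mA mC' /=.
rewrite /m' /= /pushforward /=.
transitivity ((lebesgue_measure \x lebesgue_rV R d)
  (((fun x : measurableTypeR R => (x + v ord0 ord0)%R) @^-1` A) `*`
   ((fun x : 'rV[R]_d => (x + \row_j v ord0 (lift ord0 j))%R) @^-1` C))).
  suff fE a x : row_uncons (row_cons (a, x) + v)%R =
      (a + v ord0 ord0, x + \row_j v ord0 (lift ord0 j))%R.
    by congr (_ _); apply/seteqP; split => -[a x]; rewrite /preimage /mkset fE.
  rewrite /row_uncons mxE row_cons0; congr pair.
  by apply/rowP => j; rewrite mxE [LHS]mxE row_consS [RHS]mxE; congr (_ + _)%R; rewrite mxE.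
rewrite [LHS]product_measure1E.
- by congr (_ * _); [exact: lebesgue_measure_addr | exact: IH].
- by rewrite -[X in measurable X]setTI; exact: measurable_addr.
- by rewrite -[X in measurable X]setTI; exact: measurable_rV_addr.
Qed.

End translation.

(** * Null sets of Lebesgue measure, and positivity on balls *)

Section null_sets.
Local Open Scope ereal_scope.
Context {R : realType}.

Lemma row_cons_addr d (a s : R) (x : 'rV[R]_d) :
  row_cons (a + s, x)%R = (row_cons (a, x) + s *: delta_mx ord0 ord0)%R.
Proof.
apply/rowP => i; rewrite [RHS]mxE; have [j ->|->] := unliftP ord0 i.
  rewrite !row_consS 2!mxE (eq_sym (lift _ _)) (negbTE (neq_lift _ _)).
  by rewrite andbF mulr0 addr0.
by rewrite !row_cons0 2!mxE !eqxx mulr1.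
Qed.

Lemma row_cons_addl d (a s : R) (x : 'rV[R]_d) j :
  row_cons (a, x + s *: delta_mx ord0 j)%R =
  (row_cons (a, x) + s *: delta_mx ord0 (lift ord0 j))%R.
Proof.
apply/rowP => i; rewrite [RHS]mxE; have [k ->|->] := unliftP ord0 i.
  by rewrite !row_consS [LHS]mxE; congr (_ + _)%R; rewrite !mxE (inj_eq (@lift_inj _ ord0)).
by rewrite !row_cons0 2!mxE (negbTE (neq_lift _ _)) andbF mulr0 addr0.
Qed.

(** Fubini: countable sections have length zero, so integrating along coordinate [j] first gives
    zero. Coordinates past the first are reached by induction on slices. *)
Lemma lebesgue_rV_lines_null d (j : 'I_d) (E : set 'rV[R]_d) : measurable E ->
  (forall x, countable [set s : R | E (x + s *: delta_mx ord0 j)%R]) ->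
  lebesgue_rV R d E = 0.
Proof.
elim: d => [|d IH] in j E *; first by case: j.
move=> mE cE.
have mC : measurable (@row_cons R d @^-1` E).
  by rewrite -[X in measurable X]setTI; exact: measurable_row_cons.
rewrite /= /lebesgue_succ /pushforward.
have [j'|] := unliftP ord0 j => jE.
  rewrite /product_measure1; apply: integral0_eq => a _ /=.
  apply: (IH j'); first exact: measurable_xsection.
  move=> x; apply: sub_countable (cE (row_cons (a, x))).
  apply: subset_card_le => s /=; rewrite /xsection/= inE/=.
  by rewrite jE -row_cons_addl.
rewrite [LHS](@product_measure_unique _ _ _ _ _ _ _
  (lebesgue_measure \x^ lebesgue_rV R d))//; last first.
  by move=> A B mA mB; rewrite [LHS]product_measure2E.
rewrite /product_measure2; apply: integral0_eq => y _ /=.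
apply: countable_lebesgue_measure0.
apply: sub_countable (cE (row_cons (0%R, y))).
apply: subset_card_le => s /=; rewrite /ysection/= inE/=.
by rewrite jE -row_cons_addr add0r.
Qed.

Lemma lebesgue_rV_ball_gt0 d (x : 'rV[R]_d) (e : R) : (0 < e)%R ->
  0 < lebesgue_rV R d (ball x e).
Proof.
move=> e0.
pose a : 'rV[R]_d := (x - const_mx (e / 2))%R.
pose b : 'rV[R]_d := (x + const_mx (e / 2))%R.
have : 0 < lebesgue_rV R d (box a b).
  rewrite lebesgue_rV_box; last by move=> i; rewrite !mxE; lra.
  by rewrite lte_fin prodr_gt0// => i _; rewrite !mxE; lra.
move=> /lt_le_trans; apply; apply: le_measure; rewrite ?inE.
- exact: measurable_box.
- by apply: open_measurable_mx; exact: ball_open.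
- move=> y aby; split => // i j; rewrite (ord1 i) /ball/=.
  have := aby j; rewrite !mxE ltr_norml; lra.
Qed.

Lemma lebesgue_rV_negligible_open d (U : set 'rV[R]_d) : open U ->
  (lebesgue_rV R d).-negligible U -> U = set0.
Proof.
move=> oU [N [mN N0 UN]]; apply/eqP/negPn/negP => /set0P[x Ux].
have /nbhs_ballP[e /= e0 eU] := open_nbhs_nbhs (conj oU Ux).
have := lebesgue_rV_ball_gt0 x e0; rewrite ltNge => /negP; apply.
rewrite -N0; apply: le_measure; rewrite ?inE//; last exact: subset_trans UN.
by apply: open_measurable_mx; exact: ball_open.
Qed.

End null_sets.

(** * Convex functions: local bounds and continuity *)

Section convexity.
Context {R : realType}.
Implicit Types (d : nat).

Lemma ball0E (e s : R) : ball (0 : R) e s = (`|s| < e) :> Prop.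
Proof. by rewrite -ball_normE /ball_/= sub0r normrN. Qed.

(** [D] is required to be convex along with [g]; a constant [g] makes this convexity of the set
    alone. *)
Definition convex_on d (D : set 'rV[R]_d) (g : 'rV[R]_d -> R) :=
  forall x y s, 0 <= s <= 1 -> D x -> D y ->
    D (s *: x + (1 - s) *: y) /\
    g (s *: x + (1 - s) *: y) <= s * g x + (1 - s) * g y.

(** Jensen's inequality with equal weights, by induction: the mean of [n.+2] points combines the
    last one, of weight [n.+2%:R^-1], with the mean of the others. *)
Lemma convex_on_mean d (D : set 'rV[R]_d) g (p : nat -> 'rV[R]_d) n :
  convex_on D g -> (forall i, D (p i)) ->
  D (n.+1%:R^-1 *: \sum_(i < n.+1) p i) /\
  g (n.+1%:R^-1 *: \sum_(i < n.+1) p i) <= n.+1%:R^-1 * \sum_(i < n.+1) g (p i).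
Proof.
move=> cg Dp; elim: n => [|n [Dn gn]].
  by rewrite !big_ord1 invr1 scale1r mul1r.
rewrite big_ord_recr [X in _ <= _ * X]big_ord_recr /=.
set m := \sum_(i < n.+1) p i in Dn gn *.
set t : R := n.+2%:R^-1.
have n2 : n.+2%:R != 0 :> R by rewrite pnatr_eq0.
have n1 : n.+1%:R != 0 :> R by rewrite pnatr_eq0.
have tE : 1 - t = t * n.+1%:R.
  by apply: (mulfI n2); rewrite mulrBr mulrA mulfV// mul1r mulr1 -natr1 addrK.
have t01 : 0 <= t <= 1.
  by rewrite invr_ge0 ler0n/= invf_le1// ?ler1n// ltr0n.
have [] := cg (p n.+1) (n.+1%:R^-1 *: m) t t01 (Dp _) Dn.
rewrite scalerA tE -mulrA divff// mulr1 -scalerDr (addrC (p _)) => D2 g2.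
split=> //; apply: (le_trans g2); rewrite [X in _ <= X]mulrDr [leLHS]addrC lerD2r.
rewrite -mulrA ler_wpM2l ?invr_ge0//.
by rewrite -ler_pdivlMl// ltr0n.
Qed.

Lemma convex_on_ray d (D : set 'rV[R]_d) g x w (s : R) : convex_on D g ->
  D x -> D (x + w) -> 0 <= s <= 1 ->
  D (x + s *: w) /\ g (x + s *: w) <= g x + s * (g (x + w) - g x).
Proof.
move=> cg Dx Dw s01; have [] := cg (x + w) x s s01 Dw Dx.
rewrite scalerDr addrAC -scalerDl addrC addrCA subrr addr0 scale1r addrC => ? h.
split=> //; apply: le_trans h _; lra.
Qed.

(* The point [x + z] is the mean of the points [x + d z_j e_j] on the axes
   through [x]. *)
Lemma convex_on_axes d (D : set 'rV[R]_d) g x (c : R) : convex_on D g ->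
  D x -> g x <= c ->
  (forall j, \forall s \near (0 : R),
     D (x + s *: delta_mx ord0 j) /\ g (x + s *: delta_mx ord0 j) <= c) ->
  \forall y \near x, D y /\ g y <= c.
Proof.
case: d => [|d] in D g x *.
  move=> cg Dx gx _; apply/nbhs_ballP; exists 1 => //= y _.
  by rewrite (_ : y = x)//; apply/rowP => -[].
move=> cg Dx gx /filter_forall /nbhs_ballP[e /= e0 De].
apply/nbhs_ballP; exists (e / d.+1%:R) => /=; first by rewrite divr_gt0// ltr0n.
move=> y xy.
pose z := y - x.
pose p (i : nat) := x + (d.+1%:R * z ord0 (inord i)) *: delta_mx ord0 (inord i : 'I_d.+1).
have zE i : `|d.+1%:R * z ord0 i| < e.
  rewrite normrM normr_nat mulrC -ltr_pdivlMr ?ltr0n//.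
  by case: xy => _ /(_ ord0 i); rewrite !mxE/= distrC.
have Dp i : D (p i) /\ g (p i) <= c.
  by apply: De; rewrite ball0E.
have [] := convex_on_mean d cg (fun i => (Dp i).1).
rewrite (_ : _ *: _ = y); last first.
  apply/rowP => k; rewrite mxE summxE.
  rewrite (eq_bigr (fun i : 'I_d.+1 => x ord0 k + d.+1%:R * (z ord0 i * (k == i)%:R))).
    rewrite big_split/= sumr_const card_ord -mulr_sumr.
    rewrite (bigD1 k)//= big1 => [|i ik]; last by rewrite eq_sym (negbTE ik) mulr0.
    rewrite eqxx mulr1 addr0 mulrDr mulrA mulVf ?pnatr_eq0// mul1r.
    by rewrite -[x ord0 k *+ _]mulr_natl mulrA mulVf ?pnatr_eq0// mul1r !mxE subrKC.
  by move=> i _; rewrite /p inord_val !mxE eqxx mulrA.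
move=> Dy gy; split => //; apply: le_trans gy _.
rewrite ler_pdivrMl ?ltr0n//.
apply: le_trans (_ : \sum_(i < d.+1) c <= _).
  by apply: ler_sum => i _; exact: (Dp i).2.
by rewrite sumr_const card_ord mulr_natl.
Qed.

(** Convexity bounds the growth of [g] from [x] by [|s| K] on either side, with [K] built from both
    end values; the strict inequality at [x] leaves room for it. *)
Lemma convex_on_axis d (D : set 'rV[R]_d) g x (c : R) w : convex_on D g ->
  D x -> g x < c -> D (x + w) -> D (x - w) ->
  \forall s \near (0 : R), D (x + s *: w) /\ g (x + s *: w) <= c.
Proof.
move=> cg Dx gxc Dw DNw.
pose K := `|g (x + w) - g x| + `|g (x - w) - g x|.
have K1 : 0 < K + 1 by rewrite ltr_wpDl// addr_ge0.
near=> s.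
have s1 : `|s| <= 1.
  near: s; apply/nbhs_ballP; exists 1 => //= s.
  by rewrite ball0E => /ltW.
have sK : `|s| * K <= c - g x.
  near: s; apply/nbhs_ballP; exists ((c - g x) / (K + 1)) => /=.
    by rewrite divr_gt0 ?subr_gt0.
  move=> s; rewrite ball0E ltr_pdivlMr// => /ltW.
  by apply: le_trans; rewrite ler_wpM2l// lerDl.
have [s0|s0] := leP 0 s.
  have [|D1 g1] := convex_on_ray cg Dx Dw (s := s).
    by rewrite s0 -(ger0_norm s0).
  split => //; apply: le_trans g1 _.
  rewrite -lerBrDl; apply: le_trans sK; rewrite (ger0_norm s0) ler_wpM2l//.
  by apply: le_trans (ler_norm _) _; rewrite lerDl.
have [|D1 g1] := convex_on_ray cg Dx DNw (s := - s).
  by rewrite oppr_ge0 (ltW s0)/= -(ltr0_norm s0).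
rewrite scalerN scaleNr opprK in D1 g1.
split => //; apply: le_trans g1 _.
have Ns0 : 0 <= - s by rewrite oppr_ge0 ltW.
rewrite -lerBrDl; apply: le_trans sK; rewrite (ltr0_norm s0) ler_wpM2l//.
by apply: le_trans (ler_norm _) _; rewrite lerDr.
Unshelve. all: by end_near. Qed.

Lemma near_axis d (D : set 'rV[R]_d) x w : D x -> open D ->
  \forall s \near (0 : R), D (x + s *: w).
Proof.
move=> Dx oD.
have : x + s *: w @[s --> (0 : R)] --> x + 0 *: w.
  by apply: cvgD; [exact: cvg_cst|exact: cvgZr_tmp].
by rewrite scale0r addr0; apply; exact: open_nbhs_nbhs.
Qed.

(** The upper bound near [x] comes from the axes. The lower bound follows by reflection, since [x]
    is the midpoint of [y] and its mirror image. *)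
Lemma convex_on_continuous d (D : set 'rV[R]_d) g x : open D -> convex_on D g ->
  D x -> g y @[y --> x] --> g x.
Proof.
move=> oD cg Dx; move=> V /nbhs_ballP[e' /= e'0 eV].
set e := e' / 2; have e0 : 0 < e by rewrite divr_gt0.
have ee' : e < e' by rewrite ltr_pdivrMr// ltr_pMr// ltr1n.
have up : \forall y \near x, D y /\ g y <= g x + e.
  apply: convex_on_axes => // [|j]; first by rewrite lerDl ltW.
  have /nbhs_ballP[r /= r0 rD] := near_axis (delta_mx ord0 j) Dx oD.
  have De s : `|s| < r -> D (x + s *: delta_mx ord0 j).
    by move=> sr; apply: rD; rewrite ball0E.
  have rr : `|r / 2| < r by rewrite gtr0_norm ?divr_gt0// ltr_pdivrMr// ltr_pMr// ltr1n.
  have : \forall s \near (0 : R), D (x + s *: ((r / 2) *: delta_mx ord0 j)) /\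
      g (x + s *: ((r / 2) *: delta_mx ord0 j)) <= g x + e.
    apply: convex_on_axis => //; first by rewrite ltrDl.
      exact: De.
    by rewrite -scaleNr; apply: De; rewrite normrN.
  move=> /nbhs_ballP[t /= t0 tD]; apply/nbhs_ballP.
  exists (t * (r / 2)) => /=; first by rewrite mulr_gt0// divr_gt0.
  move=> s; rewrite ball0E => st.
  have := tD (s / (r / 2)); rewrite scalerA divfK ?gt_eqF ?divr_gt0//; apply.
  rewrite ball0E normrM normfV (gtr0_norm (divr_gt0 r0 _))//.
  by rewrite ltr_pdivrMr// divr_gt0.
move/nbhs_ballP : up => [r /= r0 up]; apply/nbhs_ballP; exists r => //= y xy; apply: eV.
have [Dy gy] := up _ xy.
have xNy : ball x r (x - (y - x)).
  move: xy; rewrite !mx_norm_ball /ball_/= => xy.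
  by rewrite opprD opprK addNKr -normrN opprB.
have [Dy' gy'] := up _ xNy.
have [|_] := cg y (x - (y - x)) (1 / 2) _ Dy Dy'; first by apply/andP; split; lra.
rewrite (_ : _ *: y + _ = x); last first.
  by apply/rowP => i; rewrite !mxE; lra.
rewrite -ball_normE /ball_/= ltr_norml; lra.
Qed.

End convexity.

(** * Convex sets have negligible boundary *)

Section null_boundary.
Context {R : realType}.

(** Three distinct points of [S] could be ordered, so [S] has at most two. *)
Lemma no_middle_countable (S : set R) :
  (forall a b c, S a -> S b -> S c -> a < b -> b < c -> False) -> countable S.
Proof.
move=> noS; have [->|/set0P[a Sa]] := eqVneq S set0; first exact: countable0.
have [Sa1|/existsNP[b /not_implyP[Sb ba]]] := pselect (S `<=` [set a]).
  by apply: sub_countable (countable1 a); exact: subset_card_le.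
apply: (@sub_countable _ _ _ [set a; b]); last exact/finite_set_countable/finite_set2.
apply: subset_card_le => c Sc /=; apply: contrapT => /not_orP[ca cb].
have [ab|ab|ab] := ltgtP a b; last by case: ba; rewrite ab.
  have [ac|ac|ac] := ltgtP a c; last by case: ca; rewrite ac.
    have [bc|bc|bc] := ltgtP b c; last by case: cb; rewrite bc.
      exact: (noS a b c).
    exact: (noS a c b).
  exact: (noS c a b).
have [ac|ac|ac] := ltgtP a c; last by case: ca; rewrite ac.
  exact: (noS b a c).
have [bc|bc|bc] := ltgtP b c; last by case: cb; rewrite bc.
  exact: (noS b c a).
exact: (noS c b a).
Qed.

Let axis_segment d (C : set 'rV[R]_d) x w (a b s : R) : convex_on C (fun=> 0) ->
  C (x + a *: w) -> C (x + b *: w) -> a < b -> a <= s <= b -> C (x + s *: w).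
Proof.
move=> cC Ca Cb ab /andP[as_ sb].
have ba : 0 < b - a by rewrite subr_gt0.
have [|+ _] := cC (x + a *: w) (x + b *: w) ((b - s) / (b - a)) _ Ca Cb.
  apply/andP; split; first by rewrite divr_ge0// ?(ltW ba)// subr_ge0.
  rewrite ler_pdivrMr// mul1r; lra.
congr C; apply/rowP => i; rewrite !mxE; field.
by rewrite gt_eqF.
Qed.

(** A point that is the midpoint of a segment of [C] along each axis is interior. On a line parallel
    to axis [j] only the two extreme points of [C] can fail, so the exceptional set [N j] has
    countable sections and is null. *)
Lemma convex_interior_negligible d (C : set 'rV[R]_d) : measurable C ->
  convex_on C (fun=> 0) -> (lebesgue_rV R d).-negligible (C `\` C°).
Proof.
move=> mC cC.
pose e (j : 'I_d) : 'rV[R]_d := delta_mx ord0 j.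
pose I j (k : nat) := [set x | C (x + k.+1%:R^-1 *: e j) /\ C (x - k.+1%:R^-1 *: e j)].
pose N j := C `\` \bigcup_k I j k.
have mI j k : measurable (I j k).
  apply: measurableI.
    by rewrite -[X in measurable X]setTI; exact: measurable_rV_addr.
  by rewrite -[X in measurable X]setTI; exact: (measurable_rV_addr (- _)).
have mN j : measurable (N j).
  by apply: measurableD => //; exact: bigcupT_measurable.
have N0 j : lebesgue_rV R d (N j) = 0%E.
  apply: (lebesgue_rV_lines_null (j := j)) => // x; apply: no_middle_countable.
  move=> a b c [Ca _] [Cb NIb] [Cc _] ab bc; apply: NIb.
  have := near_infty_natSinv_lt (PosNum (ltr01 : 0 < 1 :> R)).
  have m0 : 0 < Num.min (b - a) (c - b) by rewrite lt_min !subr_gt0 ab.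
  have [k _ /(_ k (leqnn _)) kmin] := near_infty_natSinv_lt (PosNum m0).
  move=> _; have := kmin; rewrite /= lt_min => /andP[ka kc].
  have k0 : 0 < k.+1%:R^-1 :> R by rewrite invr_gt0 ltr0n.
  exists k => //; rewrite /I /=; move: {kmin} (k.+1%:R^-1) ka kc k0 => r ka kc r0.
  split.
    rewrite -addrA -scalerDl.
    apply: (axis_segment cC Ca Cc (lt_trans ab bc)).
    apply/andP; split; lra.
  rewrite -addrA -scalerBl.
  apply: (axis_segment cC Ca Cc (lt_trans ab bc)).
  apply/andP; split; lra.
have : (lebesgue_rV R d).-negligible (\big[setU/set0]_(j : 'I_d) N j).
  elim/big_ind : _ => [|A B|j _]; first exact: negligible_set0.
    exact: negligibleU.
  by apply/negligibleP; [exact: mN|exact: N0].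
apply: negligibleS => x [Cx nx]; rewrite -bigcup_seq.
apply: contrapT => noN; apply: nx.
have axis j : \forall s \near (0 : R), C (x + s *: e j).
  have [k _ [Ck Ck']] : (\bigcup_k I j k) x.
    apply: contrapT => nI; apply: noN; exists j => //=.
    by rewrite mem_index_enum.
  apply/nbhs_ballP; exists k.+1%:R^-1 => /=; first by rewrite invr_gt0 ltr0n.
  move=> s; rewrite ball0E ltr_norml => sk.
  rewrite -scaleNr in Ck'; apply: (axis_segment cC Ck' Ck); first by rewrite gtrN// invr_gt0 ltr0n.
  by case/andP: sk => /ltW -> /ltW ->.
have : \forall y \near x, C y /\ (0 : R) <= 0.
  apply: (convex_on_axes cC Cx (lexx _)) => j.
  by have := axis j; apply: filterS.
by rewrite /interior; apply: filterS => y [].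
Qed.

End null_boundary.

(** * The scalar product, and gradients as subgradients *)

Section subgradients.
Context {R : realType} {d : nat}.
Implicit Types (x y v w : 'rV[R]_d) (D : set 'rV[R]_d) (g : 'rV[R]_d -> R).

Lemma dotrVBr v x y : dotrV v (x - y) = dotrV v x - dotrV v y.
Proof. by rewrite /dotrV -sumrB; apply: eq_bigr => i _; rewrite !mxE mulrBr. Qed.

Lemma dotrVZr v (s : R) x : dotrV v (s *: x) = s * dotrV v x.
Proof. by rewrite /dotrV mulr_sumr; apply: eq_bigr => i _; rewrite mxE mulrCA. Qed.

Lemma dotrVBl v w x : dotrV (v - w) x = dotrV v x - dotrV w x.
Proof. by rewrite /dotrV -sumrB; apply: eq_bigr => i _; rewrite !mxE mulrBl. Qed.

Lemma dotrVv_eq0 v : dotrV v v <= 0 -> v = 0.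
Proof.
move=> v0; apply/rowP => i; rewrite mxE; apply/eqP; rewrite -sqrf_eq0 expr2.
have /psumr_eq0P : forall j : 'I_d, true -> 0 <= v ord0 j * v ord0 j.
  by move=> j _; rewrite -expr2 sqr_ge0.
move=> /(_ _ i)/= -> //; apply/eqP; rewrite eq_le v0/= sumr_ge0// => j _.
by rewrite -expr2 sqr_ge0.
Qed.

Lemma rV_normr_le x i : `|x ord0 i| <= `|x|.
Proof.
rewrite [leRHS]/Num.norm/= mx_normrE; apply/bigmax_geP; right => /=.
by exists (ord0, i).
Qed.

Lemma dotrV_normr_le v x : `|dotrV v x| <= d%:R * (`|v| * `|x|).
Proof.
apply: le_trans (ler_norm_sum _ _ _) _.
apply: le_trans (_ : \sum_(i < d) `|v| * `|x| <= _).
  by apply: ler_sum => i _; rewrite normrM ler_pM// rV_normr_le.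
by rewrite sumr_const card_ord mulr_natl.
Qed.

Lemma cvg_dotrV v x : dotrV v y @[y --> x] --> dotrV v x.
Proof.
have Fx := nbhs_filter x; rewrite /dotrV; elim: (index_enum _) => [|i r IH].
  rewrite big_nil (_ : (fun y => _) = cst 0); first exact: cvg_cst.
  by apply/funext => y; rewrite big_nil.
rewrite big_cons (_ : (fun y => _) = (fun y : 'rV[R]_d => v ord0 i * y ord0 i +
    \sum_(k <- r) v ord0 k * y ord0 k)).
  by apply: cvgD => //; apply: cvgMl_tmp; exact: coord_continuous.
by apply/funext => y; rewrite big_cons.
Qed.

(** Tested on [D] alone, as [fine \o phi] carries no information where [phi] is infinite. *)
Definition subgradient D g x v :=
  forall y, D y -> g x + dotrV v (y - x) <= g y.

Lemma derive_dotrV g x w : differentiable g x ->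
  'D_w g x = dotrV (\row_i 'D_(delta_mx ord0 i) g x) w.
Proof.
move=> dg; rewrite deriveE// {1}(row_sum_delta w) linear_sum/=.
by apply: eq_bigr => i _; rewrite linearZ/= mxE deriveE// mulrC.
Qed.

(** Difference quotients of a convex function at steps [h <= 1] are at most the one at step 1, and
    the derivative is their limit from the right. *)
Lemma convex_on_derive_le D g x w : convex_on D g -> D x -> D (x + w) ->
  derivable g x w -> 'D_w g x <= g (x + w) - g x.
Proof.
move=> cg Dx Dw /cvg_ex[/= l dl].
rewrite /derive (cvg_lim _ dl)// leNgt; apply/negP => gl.
have gt_near := cvgr_gt l (cvg_dnbhs_at_right dl) _ gl.
near (0 : R)^'+ => h.
have h0 : 0 < h by [].
have h1 : h <= 1 by near: h; exact: nbhs_right_le.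
have : g (x + w) - g x < h^-1 *: (g (h *: w + x) - g x)
  by near: h; exact: gt_near.
apply/negP; rewrite -leNgt [_ *: _]/(_ * _) ler_pdivrMl// lerBlDl (addrC (h *: w)).
by have [|_] := convex_on_ray cg Dx Dw (s := h); first by rewrite (ltW h0).
Unshelve. all: by end_near. Qed.

Lemma convex_on_gradient D g x : convex_on D g -> D x -> differentiable g x ->
  subgradient D g x (\row_i 'D_(delta_mx ord0 i) g x).
Proof.
move=> cg Dx dg y Dy; rewrite -derive_dotrV//.
have := convex_on_derive_le cg Dx (w := y - x).
rewrite subrKC => /(_ Dy (diff_derivable dg)); lra.
Qed.

End subgradients.

(** * Comparing measures of sets up to null sets *)

Section almost_everywhere.
Context {R : realType} {dT : measure_display} {T : measurableType dT}.
Context (mu : {measure set T -> \bar R}).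

Lemma ae_le_measure (A B : set T) : measurable A -> measurable B ->
  (\forall x \ae mu, A x -> B x) -> (mu A <= mu B)%E.
Proof.
move=> mA mB [N [mN N0 AB]].
have : (mu A <= mu (B `|` N))%E.
  apply: le_measure; rewrite ?inE//; first exact: measurableU.
  move=> x Ax; have [Bx|nBx] := pselect (B x); first by left.
  by right; apply: AB => /(_ Ax).
by move=> /le_trans; apply; rewrite -[leRHS]adde0 -N0; exact: measureU2.
Qed.

Lemma ae_measure_eq (A B : set T) : measurable A -> measurable B ->
  (\forall x \ae mu, A x <-> B x) -> mu A = mu B.
Proof.
move=> mA mB AB; apply/eqP; rewrite eq_le; apply/andP; split.
  by apply: ae_le_measure => //; apply: filterS AB => x [].
by apply: ae_le_measure => //; apply: filterS AB => x [].
Qed.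

End almost_everywhere.

(** * Atoms of pure point measures *)

Section pure_points.
Context {R : realType} {d : nat}.

Lemma closed_measurable_mx m n (F : set 'M[R]_(m, n)) : closed F -> measurable F.
Proof.
by move=> /closed_openC/open_measurable_mx/measurableC; rewrite setCK.
Qed.

Lemma measurable_set1_rV (x : 'rV[R]_d) : measurable [set x].
Proof.
apply: closed_measurable_mx; apply: accessible_closed_set1.
exact/hausdorff_accessible/norm_hausdorff.
Qed.

(** Trades the series for what the cells call for: distinct atoms of positive mass with a null
    complement. *)
Lemma pure_point_atoms (nu : {measure set 'rV[R]_d -> \bar R}) :
  pure_point nu -> exists (I : set nat) (v : nat -> 'rV[R]_d),
    [/\ set_inj I v, (forall i, I i -> 0 < nu [set v i])%E &
        nu (~` (v @` I)) = 0%E].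
Proof.
move=> [I [m [v [m0 vI m1 nuE]]]]; exists I, v; split => // [i Ii|].
  rewrite nuE; last exact: measurable_set1_rV.
  apply: (@lt_le_trans _ _ (m i)%:E); first by rewrite lte_fin m0.
  apply: esum_ge; exists [set i].
    by split; [exact: finite_set1|move=> _ ->].
  by rewrite fsbig_set1 diracE mem_set//= mule1.
rewrite nuE; last first.
  apply: measurableC; rewrite -bigcup_imset1.
  by apply: bigcup_measurable => i _; exact: measurable_set1_rV.
apply: esum1 => i Ii; rewrite diracE memNset ?mule0//.
by apply; exists i.
Qed.

End pure_points.

(** * Cells of a potential with a discrete gradient *)

Section potential_cells.
Context {R : realType} {d : nat}.
Implicit Types (Omega : set 'rV[R]_d) (phi : 'rV[R]_d -> \bar R).
Local Notation leb := (lebesgue_rV R d).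

Definition cell Omega phi (v : 'rV[R]_d) (c : R) :=
  [set x | Omega x /\ phi x = (dotrV v x + c)%:E].

(** Working form of a potential: [v] lists the atoms and [c i] is the intercept of the affine
    minorant of slope [v i]. The last two fields say that in [Omega] the fiber of [T] over [v i],
    the cell and the interior of the cell agree up to null sets. *)
Record atomic_potential Omega phi (nu : set 'rV[R]_d -> \bar R) (I : set nat)
    (v : nat -> 'rV[R]_d) (c : nat -> R) (T : 'rV[R]_d -> 'rV[R]_d) : Prop := {
  ap_inj : set_inj I v ;
  ap_fin : forall x, Omega x -> phi x \is a fin_num ;
  ap_convex : convex_on Omega (fine \o phi) ;
  ap_meas : measurable_fun setT T ;
  ap_push : forall B, measurable B -> leb (Omega `&` T @^-1` B) = nu B ;
  ap_le : forall i x, I i -> Omega x -> dotrV (v i) x + c i <= fine (phi x) ;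
  ap_subgradient : \forall x \ae leb,
    Omega x -> subgradient Omega (fine \o phi) x (T x) ;
  ap_atom : \forall x \ae leb, Omega x -> exists2 i, I i & T x = v i ;
  ap_interior : \forall x \ae leb, forall i,
    Omega x -> I i -> T x = v i -> (cell Omega phi (v i) (c i))° x ;
  ap_cell : \forall x \ae leb, forall i,
    I i -> cell Omega phi (v i) (c i) x -> T x = v i }.

Lemma convex_potential_convex_on Omega (oOmega : open Omega)
    (nu : {measure set 'rV[R]_d -> \bar R}) phi :
  @convex_set R 'rV[R]_d Omega -> convex_potential oOmega nu phi ->
  convex_on Omega (fine \o phi).
Proof.
move=> cO [_ cphi fphi _] x y s s01 Ox Oy.
have Oxy : Omega (s *: x + (1 - s) *: y).
  have /andP[s0 s1] := s01.
  have /(_ (mem_set Ox) (mem_set Oy)) := cO x y (Itv01 s0 s1).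
  by rewrite inE.
split=> //=; have := cphi x y s s01.
rewrite -(fineK (fphi _ Oxy)) -(fineK (fphi _ Ox)) -(fineK (fphi _ Oy)).
by rewrite lee_fin.
Qed.

Lemma open_superlevel Omega (h : 'rV[R]_d -> R) (r : R) : open Omega ->
  (forall x, Omega x -> h y @[y --> x] --> h x) ->
  open [set x | Omega x /\ r < h x].
Proof.
move=> oO ch; rewrite openE => x [Ox rh]; rewrite /interior.
have Fx := nbhs_filter x.
apply: filterI; first exact: open_nbhs_nbhs.
exact: (cvgr_gt (h x) (ch x Ox)).
Qed.

Lemma measurable_sublevel Omega (h : 'rV[R]_d -> R) (r : R) : open Omega ->
  (forall x, Omega x -> h y @[y --> x] --> h x) ->
  measurable [set x | Omega x /\ h x <= r].
Proof.
move=> oO ch.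
rewrite (_ : mkset _ = Omega `\` [set x | Omega x /\ r < h x]).
  apply: measurableD; first exact: open_measurable_mx.
  by apply: open_measurable_mx; exact: open_superlevel.
apply/seteqP; split => x [Ox xr]; split => //.
  by move=> [_]; rewrite ltNge xr.
by rewrite leNgt; apply/negP => ?; apply: xr.
Qed.

Lemma cvg_sub_affine Omega phi (v : 'rV[R]_d) (c : R) x : open Omega ->
  convex_on Omega (fine \o phi) -> Omega x ->
  fine (phi y) - (dotrV v y + c) @[y --> x] --> fine (phi x) - (dotrV v x + c).
Proof.
move=> oO cphi Ox; have Fx := nbhs_filter x; apply: cvgB.
  exact: (@convex_on_continuous R d Omega (fine \o phi) x oO cphi Ox).
by apply: cvgD; [exact: cvg_dotrV|exact: cvg_cst].
Qed.

Lemma cell_near Omega phi v c x : (cell Omega phi v c)° x ->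
  \forall y \near x, phi y = (dotrV v y + c)%:E.
Proof. by have Fx := nbhs_filter x; apply: filterS => y []. Qed.

Section cells.
Context Omega phi (v : 'rV[R]_d) (c : R).
Context (oOmega : open Omega)
  (fphi : forall x, Omega x -> phi x \is a fin_num)
  (cphi : convex_on Omega (fine \o phi))
  (vc_le : forall x, Omega x -> dotrV v x + c <= fine (phi x)).

(** The minorant supplies one inequality, which leaves a sublevel set of a function continuous on
    [Omega]; measurability and convexity of the cell are read off this form. *)
Lemma cellE : cell Omega phi v c =
  [set x | Omega x /\ fine (phi x) - (dotrV v x + c) <= 0].
Proof.
apply/seteqP; split => x [Ox]; first by move=> e; split => //=; rewrite e /= subrr.
move=> h; split=> //; rewrite -(fineK (fphi Ox)); congr EFin.
by apply/eqP; rewrite eq_le vc_le// andbT -subr_le0.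
Qed.

Lemma measurable_cell : measurable (cell Omega phi v c).
Proof.
rewrite cellE.
apply: (@measurable_sublevel Omega (fun x => fine (phi x) - (dotrV v x + c)) 0) => // x Ox.
exact: (cvg_sub_affine oOmega cphi Ox).
Qed.

Lemma convex_cell : convex_on (cell Omega phi v c) (fun=> 0).
Proof.
move=> x y s s01 Cx Cy; split; last by rewrite !mulr0 addr0.
move: Cx Cy; rewrite cellE => -[Ox hx] [Oy hy].
have [Oxy hxy] := cphi s01 Ox Oy; split=> //.
have /andP[s0 s1] := s01.
rewrite /= in hxy; rewrite dotrVD !dotrVZr.
have {}hx : s * fine (phi x) <= s * (dotrV v x + c).
  by rewrite ler_wpM2l// -subr_le0.
have {}hy : (1 - s) * fine (phi y) <= (1 - s) * (dotrV v y + c).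
  by rewrite ler_wpM2l// -subr_le0 // opprB; lra.
lra.
Qed.

Lemma cell_interior_ae :
  \forall x \ae leb, cell Omega phi v c x -> (cell Omega phi v c)° x.
Proof.
have := convex_interior_negligible measurable_cell convex_cell.
by apply: negligibleS => x /not_implyP.
Qed.

End cells.

(** A subgradient at one point of the fiber over [v i] fixes the intercept [c i]. Convex cells are
    interior almost everywhere, and at an interior point the gradient is the slope. *)
Lemma convex_potential_atomic Omega (oOmega : open Omega)
    (nu : {measure set 'rV[R]_d -> \bar R}) phi :
  @convex_set R 'rV[R]_d Omega -> convex_potential oOmega nu phi ->
  pure_point nu -> exists I v c T, atomic_potential Omega phi nu I v c T.
Proof.
move=> cO pot /pure_point_atoms[I [v [vI nu0 nuC]]].
have cphi := convex_potential_convex_on cO pot.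
have [_ _ fphi [T [mT Tgrad Tpush]]] := pot.
have push B : measurable B -> leb (Omega `&` T @^-1` B) = nu B.
  by move=> mB; rewrite -Tpush// /pushforward /mrestr setIC.
have subg : \forall x \ae leb, Omega x -> subgradient Omega (fine \o phi) x (T x).
  apply: filterS Tgrad => x xT Ox; have [dx ->] := xT Ox.
  exact: convex_on_gradient.
have /choice[c cP] : forall i, exists c, I i ->
    (forall x, Omega x -> dotrV (v i) x + c <= fine (phi x)) /\
    (forall x, Omega x -> subgradient Omega (fine \o phi) x (T x) -> T x = v i ->
       fine (phi x) = dotrV (v i) x + c).
  (* Outside [I] nothing is asked of the intercept, so it is set to 0. *)
  move=> i; have [Ii|nIi] := pselect (I i); last by exists 0.
  (* The atom has positive mass, so its fiber is not null and contains a point where the subgradient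
     inequality holds. *)
  have [y [Oy yT Tyv]] : exists y, [/\ Omega y,
      subgradient Omega (fine \o phi) y (T y) & T y = v i].
    apply: contrapT => noy; have := nu0 i Ii.
    rewrite -push; last exact: measurable_set1_rV.
    rewrite (_ : leb _ = 0%E) ?ltxx//; apply/negligibleP.
      apply: measurableI; first exact: open_measurable_mx.
      by rewrite -[X in measurable X]setTI; apply: mT => //; exact: measurable_set1_rV.
    move: subg; apply: negligibleS => x [Ox Tx] xs.
    by apply: noy; exists x; split => //; exact: xs.
  exists (fine (phi y) - dotrV (v i) y) => _; split => [x Ox|x Ox xT Txv].
    by have := yT _ Ox; rewrite Tyv dotrVBr/=; lra.
  (* The subgradient inequalities between [x] and [y], taken in both directions, show that [x] gives
     the same intercept as [y]. *)
  apply/eqP; rewrite eq_le; apply/andP; split.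
    by have := xT _ Oy; rewrite Txv dotrVBr/=; lra.
  by have := yT _ Ox; rewrite Tyv dotrVBr/=; lra.
have intr : \forall x \ae leb, forall i, I i ->
    cell Omega phi (v i) (c i) x -> (cell Omega phi (v i) (c i))° x.
  apply: ae_foralln => i.
  have [Ii|nIi] := pselect (I i); last by apply: aeW => x /nIi.
  apply: filterS (cell_interior_ae oOmega fphi cphi (cP i Ii).1) => x xint _.
  exact: xint.
exists I, v, c, T; split => //.
- by move=> i x Ii; exact: (cP i Ii).1.
- have : leb (Omega `&` T @^-1` (~` (v @` I))) = 0%E.
    rewrite push//; apply: measurableC; rewrite -bigcup_imset1.
    by apply: bigcup_measurable => i _; exact: measurable_set1_rV.
  move=> /negligibleP neg; have /neg : measurable (Omega `&` T @^-1` (~` (v @` I))).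
    apply: measurableI; first exact: open_measurable_mx.
    rewrite -[X in measurable X]setTI; apply: mT => //.
    apply: measurableC; rewrite -bigcup_imset1.
    by apply: bigcup_measurable => i _; exact: measurable_set1_rV.
  apply: negligibleS => x /not_implyP[Ox nx]; split => // -[i Ii vT].
  by apply: nx; exists i.
- apply: filterS2 subg intr => x xs xint i Ox Ii Txv; apply: xint => //.
  split=> //; rewrite -(fineK (fphi _ Ox)); congr EFin.
  exact: (cP i Ii).2 (xs Ox) Txv.
- apply: filterS2 Tgrad intr => x xT xint i Ii Cx.
  have [Ox _] := Cx; have [_ ->] := xT Ox.
  exact: (gradient_affine (cell_near (xint i Ii Cx))).
Qed.

End potential_cells.

(** * The flow map on cells and the measure [kappa] *)

Section flow.
Context {R : realType} {d : nat}.
Local Notation leb := (lebesgue_rV R d).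

Lemma measurable_transport (T : 'rV[R]_d -> 'rV[R]_d) (t : R) :
  measurable_fun setT T -> measurable_fun setT (fun x : 'rV[R]_d => x + t *: T x).
Proof.
move=> mT; apply: measurable_fun_rV => i.
under eq_fun do rewrite mxE mxE.
apply: measurable_funD; first exact: measurable_coord.
apply: measurable_funM; first exact: measurable_cst.
exact: (measurableT_comp (measurable_coord ord0 i) mT).
Qed.

Section kappa.
Context (Omega : set 'rV[R]_d) (phi : 'rV[R]_d -> \bar R)
  (nu : set 'rV[R]_d -> \bar R) (I : set nat) (v : nat -> 'rV[R]_d)
  (c : nat -> R) (T : 'rV[R]_d -> 'rV[R]_d).
Context (oOmega : open Omega) (ap : atomic_potential Omega phi nu I v c T).
Local Notation C i := (cell Omega phi (v i) (c i))°.

(** A ball on which [phi] is affine has positive measure, hence meets the interior of some cell; the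
    two affine functions agree near that point, so slope and intercept are those of the cell. *)
Lemma affine_locusE : affine_locus Omega phi = \bigcup_(i in I) C i.
Proof.
apply/seteqP; split => [x [Ox [w [b phix]]]|x [i Ii Cx]]; last first.
  split; first by have [] := interior_subset Cx.
  by exists (v i), (c i); exact: (cell_near Cx).
have Fx := nbhs_filter x.
have /nbhs_ballP[e /= e0 eU] : nbhs x (Omega `&` [set y | \forall z \near y,
    phi z = (dotrV w z + b)%:E]).
  apply: filterI; first exact: open_nbhs_nbhs.
  exact: (nbhs_interior phix).
have [y [xy [i Ii Cy]]] : exists y, ball x e y /\ exists2 i, I i & C i y.
  apply: contrapT => noy.
  have : ball x e = set0.
    apply: lebesgue_rV_negligible_open; first exact: ball_open.
    have : \forall y \ae leb, ~ ball x e y; last by apply: negligibleS => y xy; apply.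
    apply: filterS2 (ap_atom ap) (ap_interior ap) => y yI yC xy.
    have [Oy _] := eU _ xy; have [i Ii Ty] := yI Oy.
    by apply: noy; exists y; split => //; exists i => //; exact: yC.
  by move=> /seteqP[/(_ x) + _]; apply; exact: ballxx.
have [Oy phiy] := eU _ xy.
have wv : w = v i.
  by rewrite -(gradient_affine phiy) (gradient_affine (cell_near Cy)).
have bc : b = c i.
  have := nbhs_singleton phiy; rewrite (nbhs_singleton (cell_near Cy)) wv.
  by move=> []/addrI.
exists i => //; apply/nbhs_ballP; exists e => //= z xz.
have [Oz /nbhs_singleton phiz] := eU _ xz.
by split => //; rewrite phiz wv bc.
Qed.

Lemma flow_map_cell t i x : C i x -> flow_map phi t x = x + t *: v i.
Proof. by move=> Cx; rewrite /flow_map (gradient_affine (cell_near Cx)). Qed.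

(* Monotonicity of the subgradients makes the flow map injective. *)
Lemma flow_map_cell_inj t i j x y : 0 < t -> I i -> I j -> C i x -> C j y ->
  x + t *: v i = y + t *: v j -> i = j.
Proof.
move=> t0 Ii Ij /interior_subset[Ox phix] /interior_subset[Oy phiy] xy.
have := ap_le ap Ii Oy; have := ap_le ap Ij Ox.
rewrite phix phiy /= => jx iy.
have yx : t *: (v i - v j) = y - x.
  rewrite scalerBr; apply/eqP; rewrite subr_eq addrAC eq_sym subr_eq.
  by rewrite -xy addrC.
apply: (ap_inj ap); rewrite ?inE//; apply/eqP; rewrite -subr_eq0; apply/eqP.
apply: dotrVv_eq0; rewrite -(pmulr_rle0 _ t0) -dotrVZr yx dotrVBl !dotrVBr; lra.
Qed.

Lemma kappaE (t : R) (B : set 'rV[R]_d) : 0 < t -> measurable B ->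
  kappa oOmega phi t B = leb (Omega `&` (fun x => x + t *: T x) @^-1` B).
Proof.
move=> t0 mB; rewrite /kappa /= /mrestr.
pose P i := C i `&` (fun x => x + t *: v i) @^-1` B.
have mC i : measurable (C i) by apply: open_measurable_mx; exact: open_interior.
have mP i : measurable (P i).
  by apply: measurableI => //; rewrite -[X in measurable X]setTI;
    exact: measurable_rV_addr.
have -> : B `&` (flow_map phi t @` affine_locus Omega phi) =
    \bigcup_(i in I) ((fun x => x + - (t *: v i)) @^-1` P i).
  apply/seteqP; split => [x [Bx [y]]|x [i Ii [Cx Bx]]].
    rewrite affine_locusE => -[i Ii Cy]; rewrite (flow_map_cell _ Cy) => yx.
    exists i => //; rewrite /P /= -yx addrK; split => //.
    by rewrite -yx in Bx.
  rewrite /= subrK in Bx; split => //; exists (x - t *: v i).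
    by rewrite affine_locusE; exists i.
  by rewrite (flow_map_cell _ Cx) subrK.
rewrite measure_bigcup; first last.
- move=> i j Ii Ij [x [[Cix _] [Cjx _]]].
  by apply: (flow_map_cell_inj t0 Ii Ij Cix Cjx); rewrite !subrK.
- move=> i _; rewrite -[X in measurable X]setTI; exact: measurable_rV_addr.
(* The pieces are disjoint after the translation, by injectivity of the flow map, and before it, the
   slopes being distinct; so both unions are sums of equal terms. *)
transitivity (leb (\bigcup_(i in I) P i)).
  rewrite measure_bigcup//; last first.
    move=> i j Ii Ij [x [[Cix _] [Cjx _]]]; apply: (ap_inj ap); rewrite ?inE//.
    by rewrite -(gradient_affine (cell_near Cix)) (gradient_affine (cell_near Cjx)).
  by apply: eq_eseriesr => i _; exact: lebesgue_rV_addr.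
(* Fibers of [T] and interiors of cells agree up to null sets. *)
apply: ae_measure_eq.
- exact: bigcup_measurable.
- apply: measurableI; first exact: open_measurable_mx.
  rewrite -[X in measurable X]setTI.
  exact: (measurable_transport t (ap_meas ap)).
apply: filterS3 (ap_atom ap) (ap_interior ap) (ap_cell ap) => x xI xC xT.
split=> [[i Ii [Cx Bx]]|[Ox Bx]].
  have Cx' := interior_subset Cx; have [Ox _] := Cx'.
  by split => //=; rewrite (xT i).
have [i Ii Tx] := xI Ox; exists i => //; split; first exact: xC.
by rewrite /= -Tx.
Qed.

End kappa.

End flow.

(** * Real-valued calculus for finite measures *)

Section finite_measure_tools.
Context {R : realType} {dT : measure_display} {X : measurableType dT}.
Context (mu : {measure set X -> \bar R}) (finmu : fin_num_fun mu).
Implicit Types A B C : set X.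

Definition fmeas A := fine (mu A).

Lemma fmeasE A : measurable A -> (fmeas A)%:E = mu A.
Proof. by move=> mA; rewrite fineK// finmu. Qed.

Lemma fmeas_ge0 A : 0 <= fmeas A.
Proof. exact/fine_ge0/measure_ge0. Qed.

Lemma le_fmeas_ae A B : measurable A -> measurable B ->
  (\forall x \ae mu, A x -> B x) -> fmeas A <= fmeas B.
Proof.
by move=> mA mB AB; rewrite -lee_fin !fmeasE//; exact: ae_le_measure.
Qed.

Lemma le_fmeas A B : measurable A -> measurable B -> A `<=` B ->
  fmeas A <= fmeas B.
Proof. by move=> mA mB AB; apply: le_fmeas_ae => //; exact: aeW. Qed.

Lemma fmeasU_le A B : measurable A -> measurable B ->
  fmeas (A `|` B) <= fmeas A + fmeas B.
Proof.
move=> mA mB; rewrite -lee_fin EFinD !fmeasE//; last exact: measurableU.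
exact: measureU2.
Qed.

Lemma fmeasDI A B : measurable A -> measurable B ->
  fmeas A = fmeas (A `\` B) + fmeas (A `&` B).
Proof.
move=> mA mB; apply: EFin_inj; rewrite EFinD !fmeasE//; first exact: measureDI.
  exact: measurableI.
exact: measurableD.
Qed.

Lemma fmeas_bigsetU_le n (P : pred 'I_n) (F : 'I_n -> set X) :
  (forall i, measurable (F i)) ->
  fmeas (\big[setU/set0]_(i < n | P i) F i) <= \sum_(i < n | P i) fmeas (F i).
Proof.
move=> mF; suff [] : measurable (\big[setU/set0]_(i < n | P i) F i) /\
  fmeas (\big[setU/set0]_(i < n | P i) F i) <= \sum_(i < n | P i) fmeas (F i) by [].
elim/big_ind2 : _ => [|A a B b [mA Aa] [mB Bb]|i _].
- by split => //; rewrite /fmeas measure0.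
- split; first exact: measurableU.
  by apply: le_trans (fmeasU_le mA mB) _; exact: lerD.
- by split.
Qed.

Lemma fmeas_bigsetU n (P : pred 'I_n) (F : 'I_n -> set X) :
  (forall i, measurable (F i)) -> trivIset setT F ->
  fmeas (\big[setU/set0]_(i < n | P i) F i) = \sum_(i < n | P i) fmeas (F i).
Proof.
move=> mF tF; apply: EFin_inj; rewrite fmeasE; last first.
  exact: bigsetU_measurable.
rewrite measure_bigsetU_ord// -sumEFin.
by apply: eq_bigr => i _; rewrite fmeasE.
Qed.

End finite_measure_tools.

(** * Mass balance on the graph of leaking cells *)

Section cut.
Context {R : realType} {dT : measure_display} {X : measurableType dT}.
Context (mu : {measure set X -> \bar R}) (finmu : fin_num_fun mu).
Local Notation m := (fmeas mu).

(* Call [l -> k] an edge when [B l] meets [A k]. Mass which [B i] puts in [A k]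
   either leaves [i] for good, and then mass balance over the set [S] of nodes
   which do not lead back to [i] shows that there is little of it, or lies on a
   cycle, and then the drift of [h] along the cycle bounds [e]. *)
Lemma leakage_le (N : nat) (A B : 'I_N -> set X) (E G : set X) (i : 'I_N)
    (h e : X -> R) (K delta eps : R) :
  (forall l, measurable (A l)) -> (forall l, measurable (B l)) ->
  measurable E -> (\forall x \ae mu, G x) ->
  0 <= K -> trivIset setT B ->
  (forall l a b, G a -> G b -> B l a -> A l b -> h a - K <= h b) ->
  (forall a b, G a -> G b -> B i a -> A i b -> h a - K + e a <= h b) ->
  (forall x, G x -> ~ A i x -> e x <= N%:R * K -> E x) ->
  (forall l, m (A l) <= m (B l) + delta) -> 0 <= delta ->
  m (~` (\big[setU/set0]_(l < N) A l)) <= eps ->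
  m (B i `\` A i) <= N%:R * delta + eps *+ 2 + m E.
Proof.
move=> mA mB mE aeG K0 tB hK hKe EP Adelta delta0 Weps.
pose edge (l k : 'I_N) := `[< exists x, [/\ G x, B l x & A k x] >].
(* Going back along a path from [j] to [i], [h] drops by at most [K] at each node, and the node [i]
   contributes [e x]. *)
have path_drift x : G x -> B i x -> forall (p : seq 'I_N) j y,
    path edge j p -> last j p = i -> G y -> A j y ->
    h x + e x - (size p).+1%:R * K <= h y.
  move=> Gx Bx; elim => [|k p IH] j y /=.
    by move=> _ -> Gy Ay; have := hKe _ _ Gx Gy Bx Ay; lra.
  case/andP => /asboolP[z [Gz Bz Az]] pp lp Gy Ay.
  have := IH k z pp lp Gz Az; have := hK j z y Gz Gy Bz Ay.
  rewrite -[in X in _ -> _ -> X]natr1; lra.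
(* A point [x] of both [B i] and [A j] closes the path to a cycle, so [h x] cancels; without
   repeated nodes the path has at most [N] of them. *)
have conn_e x j : G x -> B i x -> A j x -> connect edge j i -> e x <= N%:R * K.
  move=> Gx Bx Ax /connectP[p0 pp0 lp0].
  case: (shortenP pp0) lp0 => p pp up _ lp.
  have := path_drift x Gx Bx p j x pp (esym lp) Gx Ax.
  have : (size p).+1%:R * K <= N%:R * K.
    apply: ler_wpM2r => //; rewrite ler_nat -[X in (_ <= X)%N]card_ord.
    by rewrite -[X in (X <= _)%N]/(size (j :: p)) -(card_uniqP up) max_card.
  lra.
pose S (l : 'I_N) := ~~ connect edge l i.
pose U := \big[setU/set0]_(l < N | S l) B l.
pose V := \big[setU/set0]_(l < N | S l) A l.
pose W := ~` (\big[setU/set0]_(l < N) A l).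
have mU : measurable U by exact: bigsetU_measurable.
have mV : measurable V by exact: bigsetU_measurable.
have mW : measurable W by apply: measurableC; exact: bigsetU_measurable.
have WP x : ~ W x -> exists l, A l x.
  by move/contrapT; rewrite -bigcup_seq => -[l _ ?]; exists l.
have VP x l : S l -> A l x -> V x.
  by move=> Sl Ax; rewrite /V -bigcup_seq_cond; exists l => //=; rewrite mem_index_enum.
have UP x : U x -> exists2 l, S l & B l x.
  by rewrite /U -bigcup_seq_cond => -[l /= /andP[_ Sl] Bx]; exists l.
(* An edge starting in [S] ends in [S], as otherwise its origin would lead back to [i] too. So [U]
   lies in [V] up to [W]. *)
have UVW : m U <= m (U `&` V) + m W.
  rewrite (fmeasDI finmu mU mV) addrC lerD2l; apply: (le_fmeas_ae finmu) => //.
    exact: measurableD.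
  apply: filterS aeG => x Gx [/UP[l Sl Bx] nV]; apply: contrapT => /WP[k Ax].
  have [Sk|/negPn ck] := boolP (S k); first exact/nV/(VP _ k).
  move/negP : Sl; apply; apply: connect_trans ck; apply: connect1.
  by apply/asboolP; exists x.
have mVU : m V <= m U + N%:R * delta.
  apply: le_trans (fmeas_bigsetU_le finmu _ mA) _.
  rewrite (fmeas_bigsetU finmu _ mB tB).
  apply: le_trans (_ : \sum_(l < N | S l) (m (B l) + delta) <= _).
    by apply: ler_sum => l _.
  rewrite big_split/= lerD2l.
  rewrite sumr_const -[leLHS]mulr_natl; apply: ler_wpM2r => //; rewrite ler_nat.
  by rewrite -[X in (_ <= X)%N]card_ord max_card.
(* Nearly all of [U] lies in [V], and [V] weighs little more than [U], so little of [V] is outside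
   [U]. *)
have mVDU : m (V `\` U) <= N%:R * delta + eps.
  by have := fmeasDI finmu mV mU; rewrite setIC; move: Weps UVW; rewrite -/W; lra.
apply: le_trans (_ : m ((V `\` U) `|` (W `|` E)) <= _).
  (* A point in [A j] with [j] in [S] lies in [V] but not in [U], since [i] is not in [S] and the
     [B l] are disjoint; for other [j] the cycle bound puts it in [E]. *)
  apply: (le_fmeas_ae finmu).
  - exact: measurableD.
  - by apply: measurableU; [exact: measurableD|exact: measurableU].
  - apply: filterS aeG => x Gx [Bx nAx].
    have [Wx|/WP[j Ax]] := pselect (W x); first by right; left.
    have [Sj|/negPn cj] := boolP (S j); last first.
      by right; right; apply: EP => //; exact: conn_e cj.
    left; split; first exact: VP Ax.
    move=> /UP[l Sl Bl]; have il : i = l by apply: (tB i l) => //; exists x.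
    by move: Sl; rewrite /S -il connect0.
have := fmeasU_le finmu (measurableD mV mU) (measurableU _ _ mW mE).
have := fmeasU_le finmu mW mE; move: Weps; rewrite -/W; lra.
Qed.

End cut.

(** * Stability of the fibers under convergence of the measures *)

Section stability.
Context {R : realType} {d : nat}.
Local Notation leb := (lebesgue_rV R d).

Definition lebesgue_on (Omega : set 'rV[R]_d) (oOmega : open Omega) :
    {measure set 'rV[R]_d -> \bar R} := mrestr leb (open_measurable_mx oOmega).

Section lebesgue_on.
Context (Omega : set 'rV[R]_d) (oOmega : open Omega).
Local Notation mu := (lebesgue_on oOmega).

Lemma lebesgue_onE B : mu B = leb (Omega `&` B).
Proof. by rewrite /lebesgue_on /= /mrestr setIC. Qed.

Lemma ae_lebesgue_on (P : 'rV[R]_d -> Prop) :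
  (\forall x \ae leb, Omega x -> P x) -> \forall x \ae mu, P x.
Proof.
have mO := open_measurable_mx oOmega.
move=> [N [mN N0 PN]]; exists (N `|` ~` Omega); split.
- by apply: measurableU => //; exact: measurableC.
- have : (mu (N `|` ~` Omega) <= leb N)%E.
    rewrite lebesgue_onE; apply: le_measure; rewrite ?inE//.
      by apply: measurableI => //; apply: measurableU => //; exact: measurableC.
    by move=> x [Ox [|//]].
  by rewrite N0 measure_le0 => /eqP.
- move=> x nPx; have [Ox|nOx] := pselect (Omega x); last by right.
  by left; apply: PN => /(_ Ox).
Qed.

End lebesgue_on.

Lemma ball_eventually_disjoint (v w : 'rV[R]_d) : v <> w ->
  \forall r \near (0 : R)^'+, ball v r `&` ball w r = set0.
Proof.
move=> vw; have vw0 : 0 < `|v - w| by rewrite normr_gt0 subr_eq0; apply/eqP.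
near=> r; rewrite -subset0 => x [].
rewrite !mx_norm_ball /ball_/= => vx wx.
have : `|v - w| < r + r.
  by apply: le_lt_trans (ler_distD x _ _) _; rewrite ltrD// distrC.
have : r < `|v - w| / 2.
  by near: r; apply: nbhs_right_lt; rewrite divr_gt0.
lra.
Unshelve. all: by end_near. Qed.

Context (Omega : set 'rV[R]_d) (oOmega : open Omega) (D : R)
  (D0 : 0 <= D) (Omega_diam : forall x y, Omega x -> Omega y -> `|x - y| <= D)
  (finmu : fin_num_fun (lebesgue_on oOmega)).
Local Notation mu := (lebesgue_on oOmega).
Local Notation m := (fmeas mu).

Section limit.
Context (phi : 'rV[R]_d -> \bar R) (nu : set 'rV[R]_d -> \bar R) (I : set nat)
  (v : nat -> 'rV[R]_d) (c : nat -> R) (T : 'rV[R]_d -> 'rV[R]_d).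
Context (ap : atomic_potential Omega phi nu I v c T).

(** Empty for [i] outside [I], so that unions may run over all [l < N]. *)
Definition fiber i := [set x | I i /\ T x = v i].

Lemma measurable_fiber i : measurable (fiber i).
Proof.
have [Ii|nIi] := pselect (I i); last first.
  by rewrite (_ : fiber i = set0)//; apply/seteqP; split => // x [].
rewrite (_ : fiber i = T @^-1` [set v i]).
  rewrite -[X in measurable X]setTI; apply: (ap_meas ap) => //.
  exact: measurable_set1_rV.
by apply/seteqP; split => x //= [].
Qed.

Lemma fibers_exhaust (e : R) : 0 < e ->
  \forall N \near \oo, m (~` (\big[setU/set0]_(l < N) fiber l)) <= e.
Proof.
move=> e0.
pose F N := ~` (\big[setU/set0]_(l < N) fiber l).
have mF N : measurable (F N).
  by apply: measurableC; apply: bigsetU_measurable => l _; exact: measurable_fiber.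
have F0 : mu (\bigcap_N F N) = 0%E.
  apply/negligibleP; first exact: bigcapT_measurable.
  have : \forall x \ae mu, exists2 i, I i & T x = v i.
    exact/ae_lebesgue_on/(ap_atom ap).
  apply: negligibleS => x xF [i Ii Tx]; apply: (xF i.+1 Logic.I).
  by rewrite big_ord_recr/=; right.
have : mu (F N) @[N --> \oo] --> mu (\bigcap_N F N).
  apply: nonincreasing_cvg_mu => //.
  - by rewrite ltey_eq finmu.
  - exact: bigcapT_measurable.
  - move=> a b ab; apply/subsetPset; apply: subsetC.
    rewrite -!bigcup_mkord => x [l /= la xl]; exists l => //=.
    exact: leq_trans la ab.
rewrite F0 => /fine_cvgP[_ /cvgrPdist_le/(_ e e0)].
apply: filterS => N; rewrite sub0r normrN; apply: le_trans.
by rewrite ler_norm.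
Qed.

Let excess i x := fine (phi x) - (dotrV (v i) x + c i).

Definition near_cell i (s : R) :=
  [set x | Omega x /\ excess i x <= s] `\` fiber i.

Lemma measurable_near_cell i s : measurable (near_cell i s).
Proof.
apply: measurableD; last exact: measurable_fiber.
apply: measurable_sublevel => // x Ox.
exact: (cvg_sub_affine oOmega (ap_convex ap) Ox).
Qed.

(** As [s] tends to 0 these sets shrink to the cell deprived of the fiber, which is null. *)
Lemma near_cell_small i (e : R) : I i -> 0 < e ->
  exists2 s : R, 0 < s & m (near_cell i s) <= e.
Proof.
move=> Ii e0; pose F k := near_cell i k.+1%:R^-1.
have mF k : measurable (F k) by exact: measurable_near_cell.
have F0 : mu (\bigcap_k F k) = 0%E.
  apply/negligibleP; first exact: bigcapT_measurable.
  have : \forall x \ae mu, cell Omega phi (v i) (c i) x -> T x = v i.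
    apply: ae_lebesgue_on; apply: filterS (ap_cell ap) => x xT _.
    exact: xT.
  apply: negligibleS => x xF xT.
  have [[Ox _] nx] := xF 0%N Logic.I.
  apply: nx; split => //; apply: xT; split => //.
  rewrite -(fineK (ap_fin ap Ox)); congr EFin; apply/eqP.
  rewrite eq_le (ap_le ap Ii Ox) andbT -subr_le0 leNgt; apply/negP => ex.
  have [k _ /(_ k (leqnn _)) /=] := near_infty_natSinv_lt (PosNum ex).
  by rewrite ltNge; have [[_ ->]] := xF k Logic.I.
have : mu (F k) @[k --> \oo] --> mu (\bigcap_k F k).
  apply: nonincreasing_cvg_mu => //.
  - by rewrite ltey_eq finmu.
  - exact: bigcapT_measurable.
  - move=> a b ab; apply/subsetPset; apply: setSD => x [Ox xb]; split => //.
    by apply: le_trans xb _; rewrite lef_pV2 ?posrE ?ltr0n// ler_nat.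
rewrite F0 => /fine_cvgP[_ /cvgrPdist_le/(_ e e0)[k _ /(_ k (leqnn _))]] /=.
rewrite sub0r normrN => ke; exists k.+1%:R^-1; first by rewrite invr_gt0 ltr0n.
by apply: le_trans ke; rewrite ler_norm.
Qed.

Section sequence.
Context (phi_ : nat -> 'rV[R]_d -> \bar R) (T_ : nat -> 'rV[R]_d -> 'rV[R]_d).
Context (mT_ : forall n, measurable_fun setT (T_ n))
  (subT_ : forall n, \forall x \ae leb,
     Omega x -> subgradient Omega (fine \o phi_ n) x (T_ n x))
  (liminf_ : forall i (r e : R), 0 < r -> 0 < e -> \forall n \near \oo,
     m (T @^-1` [set v i]) <= m (T_ n @^-1` ball (v i) r) + e).

(** Applies [leakage_le] with [h] the difference of [phi_ n] and [phi], and [e] the excess over the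
    [i]-th minorant; comparing masses then turns leakage out of the fiber into mass missing from
    it. *)
Lemma fiber_stable i (r e : R) : I i -> 0 < r -> 0 < e ->
  \forall n \near \oo, m (fiber i `\` T_ n @^-1` ball (v i) r) <= e.
Proof.
move=> Ii r0 e0.
have e8 : 0 < e / 8 by rewrite divr_gt0.
have [N iN WN] : exists2 N, (i < N)%N &
    m (~` (\big[setU/set0]_(l < N) fiber l)) <= e / 8.
  have [N0 _ N0P] := fibers_exhaust e8.
  exists (maxn i.+1 N0); first exact: leq_maxl.
  by apply: N0P; exact: leq_maxr.
have [s s0 Es] := near_cell_small Ii e8.
(* [K r'] bounds the pairing of a vector of norm at most [r'] with a difference of two points of
   [Omega]; the factor [d] is due to the sup norm. *)
pose K (r' : R) := d%:R * (r' * D).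
have [r' [r'0 r'r r'K r'disj]] : exists r', [/\ 0 < r', r' <= r,
    N%:R * K r' <= s &
    forall l k : 'I_N, I l -> I k -> l != k ->
      ball (v l) r' `&` ball (v k) r' = set0].
  have disj : \forall r' \near (0 : R)^'+, forall l k : 'I_N, I l -> I k ->
      l != k -> ball (v l) r' `&` ball (v k) r' = set0.
    apply: filter_forall => l; apply: filter_forall => k.
    have [[Il [Ik lk]]|nlk] := pselect (I l /\ I k /\ l != k); last first.
      by apply: nearW => r' Il Ik lk; case: nlk.
    have /ball_eventually_disjoint : v l <> v k.
      move=> vlk; move/eqP : lk; apply; apply: val_inj.
      by apply: (ap_inj ap) => //; rewrite inE.
    by apply: filterS => r' + _ _ _.
  have small : \forall r' \near (0 : R)^'+, N%:R * K r' <= s.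
    have KE r' : N%:R * K r' = r' * (N%:R * d%:R * D) by rewrite /K; ring.
    have [ND|ND] := leP (N%:R * d%:R * D) 0.
      near=> r'; rewrite KE; apply: le_trans (ltW s0).
      by apply: mulr_ge0_le0 => //; apply: ltW.
    near=> r'; rewrite KE -ler_pdivlMr//; near: r'; apply: nbhs_right_le.
    exact: divr_gt0.
  near (0 : R)^'+ => r'; exists r'; split.
  - by [].
  - by near: r'; exact: nbhs_right_le.
  - by near: r'; exact: small.
  - by near: r'; exact: disj.
(* [N] copies of [delta] enter the leakage bound and one more the final exchange of differences. *)
pose delta := e / 8 / N.+1%:R.
have delta0 : 0 < delta by rewrite divr_gt0// ltr0n.
have ineq : \forall n \near \oo, forall l : 'I_N,
    m (T @^-1` [set v l]) <= m (T_ n @^-1` ball (v l) r') + delta.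
  by apply: filter_forall => l; exact: liminf_.
apply: filterS ineq => n ineq.
pose A (l : 'I_N) := fiber l.
pose B (l : 'I_N) := [set x | I l /\ ball (v l) r' (T_ n x)].
have mBn w r1 : measurable (T_ n @^-1` ball w r1).
  rewrite -[X in measurable X]setTI; apply: mT_ => //.
  by apply: open_measurable_mx; exact: ball_open.
have mA l : measurable (A l) by exact: measurable_fiber.
have BE (l : 'I_N) : I l -> B l = T_ n @^-1` ball (v l) r'.
  by move=> Il; apply/seteqP; split => x //= [].
have mB l : measurable (B l).
  have [Il|nIl] := pselect (I l); first by rewrite BE.
  by rewrite (_ : B l = set0)//; apply/seteqP; split => // x [].
have AE (l : 'I_N) : I l -> A l = T @^-1` [set v l].
  by move=> Il; apply/seteqP; split => x //= [].
have AB l : m (A l) <= m (B l) + delta.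
  have [Il|nIl] := pselect (I l); first by rewrite AE// BE.
  rewrite (_ : A l = set0); last by apply/seteqP; split => // x [].
  by rewrite /fmeas measure0 addr_ge0 ?fmeas_ge0// ltW.
pose i' := Ordinal iN.
pose G x := [/\ Omega x, subgradient Omega (fine \o phi_ n) x (T_ n x) &
  forall l, I l -> T x = v l -> fine (phi x) = dotrV (v l) x + c l].
have aeG : \forall x \ae mu, G x.
  apply: ae_lebesgue_on.
  apply: filterS2 (subT_ n) (ap_interior ap) => x xs xC Ox.
  split => //; first exact: xs.
  move=> l Il Tx; have := nbhs_singleton (cell_near (xC l Ox Il Tx)).
  by move=> ->.
(* The subgradient of [phi_ n] at [a] is within [r'] of [v l], while [phi] meets its [l]-th minorant
   at [b]. *)
have drift l a b : G a -> G b -> B l a -> A l b ->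
    (fine (phi_ n a) - fine (phi a)) - K r' + excess l a <=
    fine (phi_ n b) - fine (phi b).
  move=> [Oa sa _] [Ob _ fb] [Il al] [_ bl].
  rewrite (fb l Il bl) /excess; have /= := sa b Ob.
  have : dotrV (v l - T_ n a) (b - a) <= K r'.
    apply: le_trans (ler_norm _) _; apply: le_trans (dotrV_normr_le _ _) _.
    rewrite /K ler_wpM2l// ler_pM//; last exact: Omega_diam.
    by move: al; rewrite mx_norm_ball /ball_/= => /ltW.
  by rewrite dotrVBl !dotrVBr; lra.
have K0 : 0 <= K r' by rewrite /K !mulr_ge0// ltW.
have tB : trivIset setT B.
  move=> l k _ _ [x [[Il xl] [Ik xk]]]; apply: contrapT => /eqP lk.
  by have := r'disj l k Il Ik lk; rewrite -subset0 => /(_ (T_ n x)); apply.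
have drift0 l a b : G a -> G b -> B l a -> A l b ->
    (fine (phi_ n a) - fine (phi a)) - K r' <= fine (phi_ n b) - fine (phi b).
  move=> Ga Gb Ba Ab; have := drift l a b Ga Gb Ba Ab.
  have [Il _] := Ba; have [Oa _ _] := Ga.
  by have := ap_le ap Il Oa; rewrite /excess; lra.
have EP x : G x -> ~ A i' x -> excess i x <= N%:R * K r' -> near_cell i s x.
  by move=> [Ox _ _] nx ex; split => //; split => //; exact: le_trans r'K.
have leak := leakage_le finmu mA mB (measurable_near_cell i s) aeG K0 tB
  drift0 (drift i') EP AB (ltW delta0) WN.
have dE : N%:R * delta + delta = e / 8.
  by rewrite -[X in _ + X]mul1r -mulrDl natr1 /delta mulrC divfK// pnatr_eq0.
have sub : m (fiber i `\` T_ n @^-1` ball (v i) r) <= m (A i' `\` B i').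
  apply: (le_fmeas finmu).
  - exact: measurableD (measurable_fiber i) (mBn (v i) r).
  - exact: measurableD.
  - move=> x [Ax nx]; split => // -[_ Bx]; apply: nx.
    exact: le_ball Bx.
(* Removing the common part, [A i'] minus [B i'] weighs at most [delta] more than [B i'] minus
   [A i']. *)
have := fmeasDI finmu (mA i') (mB i'); have := fmeasDI finmu (mB i') (mA i').
rewrite setIC; have := AB i'; rewrite mulr2n in leak; lra.
Unshelve. all: by end_near. Qed.

End sequence.
End limit.
End stability.

(** * Integrals of bounded functions *)

Section bounded_integrals.
Context {R : realType} {dT : measure_display} {X : measurableType dT}.
Context (mu : {measure set X -> \bar R}) (finmu : fin_num_fun mu).

Lemma bounded_integrable (f : X -> R) (M : R) :
  measurable_fun setT (f : _ -> measurableTypeR R) -> (forall x, `|f x| <= M) ->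
  mu.-integrable setT (EFin \o f).
Proof.
move=> mf fM; apply: measurable_bounded_integrable => //.
  by rewrite ltey_eq finmu.
exists M; split; first exact: num_real.
by move=> N MN x _; apply: le_trans (ltW MN).
Qed.

Lemma integral_dist_le (f g : X -> R) (M w : R) (E : set X) :
  measurable_fun setT (f : _ -> measurableTypeR R) ->
  measurable_fun setT (g : _ -> measurableTypeR R) ->
  (forall x, `|f x| <= M) -> (forall x, `|g x| <= M) -> measurable E ->
  0 <= w -> (forall x, ~ E x -> `|f x - g x| <= w) ->
  `|fine (\int[mu]_x (f x)%:E) - fine (\int[mu]_x (g x)%:E)|
    <= w * fmeas mu setT + M *+ 2 * fmeas mu E.
Proof.
move=> mf mg fM gM mE w0 fgw.
have If := bounded_integrable mf fM; have Ig := bounded_integrable mg gM.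
have finf := integrable_fin_num measurableT If.
have fing := integrable_fin_num measurableT Ig.
(* Nonnegativity of [M] is read off at a point of [X]; if there is none, both sides vanish. *)
have [x0|X0] := pselect (exists x : X, True); last first.
  have Xset0 : [set: X] = set0.
    by apply/seteqP; split => // x _; apply: X0; exists x.
  have E0 : E = set0 by apply/seteqP; split => // x _; apply: X0; exists x.
  by rewrite Xset0 E0 !integral_set0 /fmeas !measure0 !mulr0 addr0 subrr normr0.
have M0 : 0 <= M by have [x _] := x0; exact: le_trans (fM x).
rewrite -lee_fin -abse_EFin EFinB !fineK//.
rewrite -integralB_EFin//.
apply: le_trans (le_abse_integral _ _ _) _ => //.
  by apply: emeasurable_funB; [exact/measurable_EFinP|exact/measurable_EFinP].
rewrite EFinD !EFinM !fmeasE//.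
have <- : (\int[mu]_x (\1_E x)%:E = mu E)%E by rewrite integral_indic// setIT.
rewrite -integral_cst//.
rewrite -ge0_integralZl_EFin//; last first.
- by rewrite mulrn_wge0.
- by apply/measurable_EFinP; exact: measurable_indic.
rewrite -ge0_integralD//; last first.
- by apply/measurable_EFinP; apply: measurable_funM => //; exact: measurable_indic.
- by move=> x _; rewrite -EFinM lee_fin mulr_ge0// mulrn_wge0.
apply: ge0_le_integral => //.
- by apply: measurableT_comp => //; apply: emeasurable_funB;
    [exact/measurable_EFinP|exact/measurable_EFinP].
- apply/measurable_EFinP; apply: measurable_funD => //.
  by apply: measurable_funM => //; exact: measurable_indic.
move=> x _; rewrite -EFinB abse_EFin -EFinM -EFinD lee_fin indicE.
have [Ex|nEx] := pselect (E x).
  rewrite mem_set// mulr1 mulr2n; apply: le_trans (ler_normB _ _) _.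
  by rewrite ler_wpDl// lerD.
by rewrite memNset// mulr0 addr0; exact: fgw.
Qed.

End bounded_integrals.

(** * Functions vanishing at infinity, and tent functions *)

Section vanishing.
Context {R : realType} {d : nat}.
Implicit Types f : 'rV[R]_d -> R.

Lemma vanishing_bounded f : continuous f -> vanishes_at_infinity f ->
  exists M, forall x, `|f x| <= M.
Proof.
move=> cf /(_ 1 ltr01)[K cK fK].
have : compact (f @` K) by apply: continuous_compact => //; exact: continuous_subspaceT.
move=> /compact_bounded[M [_ MP]]; exists (Num.max 1 (M + 1)) => x.
have [Kx|nKx] := pselect (K x); last by rewrite le_max (ltW (fK _ nKx)).
by rewrite le_max (MP (M + 1)) ?orbT// ?ltrDl//; exists x.
Qed.

(** Compactness gives a uniform radius as soon as one of the points lies in [K]; if neither does,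
    both values are below [w / 2]. *)
Lemma vanishing_unif_continuous f (w : R) : continuous f ->
  vanishes_at_infinity f -> 0 < w ->
  exists2 r : R, 0 < r & forall x y, `|x - y| < r -> `|f x - f y| <= w.
Proof.
move=> cf fv w0; have w2 : 0 < w / 2 by rewrite divr_gt0.
have [K cK fK] := fv _ w2.
have : \forall r \near (0 : R)^'+, K `<=` [set x | forall y, `|x - y| < r ->
    `|f x - f y| <= w].
  apply: (compact_near_coveringP K).1 => // x Kx.
  have /nbhs_ballP[e /= e0 eP] : nbhs x [set y | `|f x - f y| <= w / 2].
    have Fx := nbhs_filter x.
    by have /cvgrPdist_le := cf x; apply.
  exists (ball x (e / 2), [set r | r < e / 2]).
    split; first by apply: nbhsx_ballx; rewrite divr_gt0.
    by apply: nbhs_right_lt; rewrite divr_gt0.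
  move=> [y r] [/= xy re] z yz.
  have fy : `|f x - f y| <= w / 2.
    by apply: eP; apply: le_ball xy; rewrite ler_pdivrMr// ler_pMr// ler1n.
  have fz : `|f x - f z| <= w / 2.
    apply: eP; rewrite [e]splitr; apply: ball_triangle xy _.
    by rewrite mx_norm_ball /ball_/=; exact: lt_trans re.
  rewrite [w]splitr; apply: le_trans (ler_distD (f x) _ _) _.
  by rewrite lerD// distrC.
move=> KP; near (0 : R)^'+ => r.
have rK : K `<=` [set x | forall y, `|x - y| < r -> `|f x - f y| <= w].
  by near: r; exact: KP.
exists r => // x y xy.
have [Kx|nKx] := pselect (K x); first exact: rK.
have [Ky|nKy] := pselect (K y); first by rewrite distrC; apply: rK => //; rewrite distrC.
apply: le_trans (ler_normB _ _) _; rewrite [w]splitr.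
by rewrite lerD// ltW// fK.
Unshelve. all: by end_near. Qed.

(** The positive part of [1 - |y - v| / r], written with an absolute value so that continuity
    follows from that of the norm. *)
Definition tent (v : 'rV[R]_d) (r : R) y : R :=
  ((1 - `|y - v| / r) + `|1 - `|y - v| / r|) / 2.

Lemma tentE v r y : tent v r y = Num.max 0 (1 - `|y - v| / r).
Proof.
rewrite /tent; set a := 1 - _; have [a0|a0] := leP 0 a.
  by rewrite ger0_norm//; lra.
by rewrite ltr0_norm// subrr mul0r.
Qed.

Lemma tent_ge0 v r y : 0 <= tent v r y.
Proof. by rewrite tentE le_max lexx. Qed.

Lemma tent_le1 v r y : 0 < r -> tent v r y <= 1.
Proof. by move=> r0; rewrite tentE ge_max ler01/= gerBl divr_ge0// ltW. Qed.

Lemma tent_out v r y : 0 < r -> r <= `|y - v| -> tent v r y = 0.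
Proof.
by move=> r0 ry; rewrite tentE max_l// subr_le0 ler_pdivlMr// mul1r.
Qed.

Lemma tent_center v r : tent v r v = 1.
Proof. by rewrite tentE subrr normr0 mul0r subr0 max_r. Qed.

Lemma continuous_tent v r : continuous (tent v r).
Proof.
move=> y; have Fy := nbhs_filter y.
suff : tent v r z @[z --> (y : 'rV[R]_d)] --> tent v r y by [].
rewrite /tent.
have a : 1 - `|z - v| / r @[z --> (y : 'rV[R]_d)] --> 1 - `|y - v| / r.
  apply: cvgB; first exact: cvg_cst.
  apply: cvgMr_tmp; apply: cvg_norm; apply: cvgB; last exact: cvg_cst.
  exact: cvg_id.
apply: cvgMr_tmp; apply: cvgD => //; exact: cvg_norm.
Qed.

Lemma tent_vanishes v r : 0 < r -> vanishes_at_infinity (tent v r).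
Proof.
move=> r0 e e0; exists [set y | `|y - v| <= r].
  apply: bounded_closed_compact.
    exists (r + `|v|); split; first exact: num_real.
    move=> M rM y /= yr; apply: le_trans (ltW rM).
    by rewrite -[y in leLHS](subrK v); apply: le_trans (ler_normD _ _) _; rewrite lerD2r.
  rewrite (_ : mkset _ = closed_ball v r); first exact: closed_ball_closed.
  rewrite closed_ballE//; apply/seteqP; split => y; by rewrite /closed_ball_/= distrC.
by move=> y /negP; rewrite -ltNge => /ltW ry; rewrite tent_out// normr0.
Qed.

(** The tent of radius [r] lies between the indicators of the point and of the ball, and its
    integrals converge. *)
Lemma weak_star_atom_le (nu_ : nat -> {measure set 'rV[R]_d -> \bar R})
    (nu : {measure set 'rV[R]_d -> \bar R}) v (r e : R) :
  weak_star_cvg nu_ nu -> 0 < r -> 0 < e ->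
  \forall n \near \oo, fmeas nu [set v] <= fmeas (nu_ n) (ball v r) + e.
Proof.
move=> [fin_ fin cvg_] r0 e0.
have mt : measurable_fun setT (tent v r : _ -> measurableTypeR R).
  by apply: continuous_measurable_rV; exact: continuous_tent.
have t1 y : `|tent v r y| <= 1 by rewrite ger0_norm ?tent_ge0// tent_le1.
have mB : measurable (ball v r : set 'rV[R]_d).
  by apply: open_measurable_mx; exact: ball_open.
have mv := measurable_set1_rV v.
have fint := integrable_fin_num measurableT (bounded_integrable fin mt t1).
have fint_ n := integrable_fin_num measurableT (bounded_integrable (fin_ n) mt t1).
have lo : fmeas nu [set v] <= fine (\int[nu]_x (tent v r x)%:E).
  rewrite -lee_fin fmeasE// fineK// -[X in nu X]setIT -integral_indic//.
  apply: ge0_le_integral => //.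
  - by apply/measurable_EFinP; exact: measurable_indic.
  - exact/measurable_EFinP.
  move=> x _; rewrite lee_fin indicE; have [->|/eqP xv] := pselect (x = v).
    by rewrite tent_center mem_set.
  by rewrite memNset ?tent_ge0//=; exact/eqP.
have up n : fine (\int[nu_ n]_x (tent v r x)%:E) <= fmeas (nu_ n) (ball v r).
  rewrite -lee_fin fmeasE// fineK// -[X in nu_ n X]setIT -integral_indic//.
  apply: ge0_le_integral => //.
  - by move=> x _; rewrite lee_fin tent_ge0.
  - exact/measurable_EFinP.
  - by apply/measurable_EFinP; exact: measurable_indic.
  move=> x _; rewrite lee_fin indicE; have [xr|xr] := pselect (ball v r x).
    by rewrite mem_set// tent_le1.
  rewrite memNset// tent_out// leNgt; apply/negP => h; apply: xr.
  by rewrite mx_norm_ball /ball_/= distrC.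
have := cvg_ _ (@continuous_tent v r) (tent_vanishes v r0).
rewrite -(fineK fint) => /fine_cvgP[_ /cvgrPdist_le/(_ e e0)].
apply: filterS => n /=; rewrite ler_norml; have := up n; move: lo; lra.
Qed.

End vanishing.

(** * Integrals against [kappa] as integrals over [Omega] *)

Section flow_integral.
Context {R : realType} {d : nat}.

Lemma bounded_set_diam (Omega : set 'rV[R]_d) : bounded_set Omega ->
  exists2 D : R, 0 <= D & forall x y, Omega x -> Omega y -> `|x - y| <= D.
Proof.
move=> [M [_ MP]]; pose N := `|M| + 1.
have NP x : Omega x -> `|x| <= N.
  by move=> Ox; apply: MP => //; rewrite /N ltr_pwDr// ler_norm.
exists (N + N) => [|x y Ox Oy]; first by rewrite /N !addr_ge0.
by apply: le_trans (ler_normB _ _) _; rewrite lerD// NP.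
Qed.

Context (Omega : set 'rV[R]_d) (oOmega : open Omega)
  (finmu : fin_num_fun (lebesgue_on oOmega)).
Context (phi : 'rV[R]_d -> \bar R) (nu : set 'rV[R]_d -> \bar R) (I : set nat)
  (v : nat -> 'rV[R]_d) (c : nat -> R) (T : 'rV[R]_d -> 'rV[R]_d)
  (ap : atomic_potential Omega phi nu I v c T).
Local Notation mu := (lebesgue_on oOmega).

Lemma kappa_fin_num t : 0 < t -> fin_num_fun (kappa oOmega phi t).
Proof.
move=> t0 B mB; rewrite (kappaE oOmega ap t0 mB) -lebesgue_onE.
apply: finmu; rewrite -[X in measurable X]setTI.
exact: (measurable_transport t (ap_meas ap)).
Qed.

Lemma kappa_integral t (f : 'rV[R]_d -> R) (M : R) : 0 < t ->
  measurable_fun setT (f : _ -> measurableTypeR R) -> (forall x, `|f x| <= M) ->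
  (\int[kappa oOmega phi t]_x (f x)%:E = \int[mu]_x (f (x + t *: T x))%:E)%E.
Proof.
move=> t0 mf fM; have mY := measurable_transport t (ap_meas ap).
rewrite (@eq_measure_integral _ _ _ setT (pushforward_by mu mY)) => [|B mB _].
  rewrite [LHS]integral_pushforward//; first exact/measurable_EFinP.
  apply: (bounded_integrable finmu (M := M)) => //.
  exact: (measurableT_comp mf mY).
by rewrite (kappaE oOmega ap t0 mB) -lebesgue_onE.
Qed.

End flow_integral.

(** * Weak-* convergence of the measures [kappa] *)

(* In the index type [option nat], [None] stands for the index infinity. *)
Theorem theorem7p1 (R : realType) (d : nat) (Omega : set 'rV[R]_d)
    (bOmega : bounded_set Omega)
    (cOmega : @convex_set R 'rV[R]_d Omega)
    (oOmega : open Omega)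
    (Omega1 : lebesgue_rV R d Omega = 1%E)
    (nu : option nat -> probability 'rV[R]_d R)
    (nu_pp : forall n, pure_point (nu n))
    (phi : option nat -> 'rV[R]_d -> \bar R)
    (phi_pot : forall n, convex_potential oOmega (nu n) (phi n))
    (nu_cvg : weak_star_cvg (fun n => nu (Some n)) (nu None))
    (t : R) (t0 : 0 < t) :
  weak_star_cvg (fun n => kappa oOmega (phi (Some n)) t)
    (kappa oOmega (phi None) t).
Proof.
pose mu := lebesgue_on oOmega.
have finmu : fin_num_fun mu.
  by apply: lty_fin_num_fun; rewrite lebesgue_onE setIT Omega1 ltry.
have atomic n := convex_potential_atomic cOmega (phi_pot n) (nu_pp n).
have [I [v [c [T ap]]]] := atomic None.
have /choice[T_ apT] : forall n, exists S, exists I v c,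
    atomic_potential Omega (phi (Some n)) (nu (Some n)) I v c S.
  by move=> n; have [I' [v' [c' [S apS]]]] := atomic (Some n);
    exists S, I', v', c'.
split => [n||f cf f0].
- by have [I' [v' [c' ap']]] := apT n; exact: (kappa_fin_num finmu ap' t0).
- exact: (kappa_fin_num finmu ap t0).
have mT_ n : measurable_fun setT (T_ n).
  by have [I' [v' [c' ap']]] := apT n; exact: ap_meas ap'.
have subT_ n : \forall x \ae lebesgue_rV R d,
    Omega x -> subgradient Omega (fine \o phi (Some n)) x (T_ n x).
  by have [I' [v' [c' ap']]] := apT n; exact: ap_subgradient ap'.
(* The maps push Lebesgue measure on [Omega] to the given measures, so the bound on atoms passes to
   preimages. *)
have liminf_ i (r e : R) : 0 < r -> 0 < e -> \forall n \near \oo,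
    fmeas mu (T @^-1` [set v i]) <= fmeas mu (T_ n @^-1` ball (v i) r) + e.
  move=> r0 e0; apply: filterS (weak_star_atom_le (v i) nu_cvg r0 e0) => n.
  have [I' [v' [c' ap']]] := apT n.
  rewrite /fmeas !lebesgue_onE (ap_push ap) ?(ap_push ap')//.
    by apply: open_measurable_mx; exact: ball_open.
  exact: measurable_set1_rV.
have [D D0 diam] := bounded_set_diam bOmega.
have stable := fiber_stable D0 diam finmu ap mT_ subT_ liminf_.
have mf := continuous_measurable_rV cf.
have [M fM] := vanishing_bounded cf f0.
pose Y x := x + t *: T x; pose Y_ n x := x + t *: T_ n x.
have mfY : measurable_fun setT ((fun x => f (Y x)) : _ -> measurableTypeR R).
  exact: (measurableT_comp mf (measurable_transport t (ap_meas ap))).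
have mfY_ n : measurable_fun setT ((fun x => f (Y_ n x)) : _ -> measurableTypeR R).
  exact: (measurableT_comp mf (measurable_transport t (mT_ n))).
rewrite (kappa_integral finmu ap t0 mf fM).
rewrite [X in X @ _](_ : _ = fun n => \int[mu]_x (f (Y_ n x))%:E)%E; last first.
  apply/funext => n; have [I' [v' [c' ap']]] := apT n.
  exact: (kappa_integral finmu ap' t0 mf fM).
rewrite -[X in _ --> X]fineK; last first.
  exact: (integrable_fin_num measurableT (bounded_integrable finmu mfY (fun x => fM _))).
apply/fine_cvgP; split.
  apply: nearW => n.
  exact: (integrable_fin_num measurableT (bounded_integrable finmu (mfY_ n) (fun x => fM _))).
apply/cvgrPdist_le => e e0.
have M0 : 0 <= M by exact: le_trans (fM 0).
have [rho rho0 frho] := vanishing_unif_continuous cf f0 (divr_gt0 e0 (ltr0Sn _ 1)).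
(* The flow maps differ by [t] times the difference of [T] and [T_ n], so values within [r] give
   arguments of [f] within [rho]. *)
pose r := rho / t; have r0 : 0 < r by exact: divr_gt0.
(* Chosen to give [2 M eta <= e / 2]; the added 1 covers [M = 0]. *)
pose eta := e / (4 * (M + 1)).
have eta0 : 0 < eta by rewrite divr_gt0// mulr_gt0// ltr_wpDl.
have eta2 : 0 < eta / 2 by rewrite divr_gt0.
have [N _ /(_ N (leqnn N)) WN] := fibers_exhaust finmu ap eta2.
(* Half of [eta] is shared among the [N] fibers; [N.+1] keeps the divisor nonzero when [N] is 0. *)
pose delta := eta / 2 / N.+1%:R.
have delta0 : 0 < delta by rewrite divr_gt0.
have : \forall n \near \oo, forall l : 'I_N,
    fmeas mu (fiber I v T l `\` T_ n @^-1` ball (v l) r) <= delta.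
  apply: filter_forall => l; have [Il|nIl] := pselect (I l); first exact: stable.
  apply: nearW => n; rewrite (_ : fiber I v T l = set0) ?set0D.
    by rewrite /fmeas measure0 ltW.
  by apply/seteqP; split => // x [].
apply: filterS => n small.
have mB (l : 'I_N) : measurable (fiber I v T l `\` T_ n @^-1` ball (v l) r).
  apply: measurableD; first exact: (measurable_fiber ap).
  rewrite -[X in measurable X]setTI; apply: mT_ => //.
  by apply: open_measurable_mx; exact: ball_open.
pose W := ~` (\big[setU/set0]_(l < N) fiber I v T l).
have mW : measurable W.
  by apply: measurableC; apply: bigsetU_measurable => l _; exact: (measurable_fiber ap).
(* Outside [W] and [V], [T] takes one of the first [N] atoms as value and [T_ n] is within [r] of
   it. *)
pose V := \big[setU/set0]_(l < N) (fiber I v T l `\` T_ n @^-1` ball (v l) r).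
have mV : measurable V by exact: bigsetU_measurable.
have mWV : measurable (W `|` V) by exact: measurableU.
have WVeta : fmeas mu (W `|` V) <= eta.
  apply: le_trans (fmeasU_le finmu mW mV) _; rewrite [eta]splitr lerD//.
  apply: le_trans (fmeas_bigsetU_le finmu _ mB) _.
  apply: le_trans (_ : \sum_(l < N) delta <= _); first exact: ler_sum.
  rewrite sumr_const card_ord -[leLHS]mulr_natr.
  have -> : eta / 2 = delta * N.+1%:R by rewrite divfK// pnatr_eq0.
  by apply: ler_wpM2l; [exact: ltW|rewrite ler_nat].
have close x : ~ (W `|` V) x -> `|f (Y x) - f (Y_ n x)| <= e / 2.
  move=> /not_orP[/contrapT + nV]; rewrite -bigcup_seq => -[l _ [Il Tx]].
  apply: frho; rewrite /Y /Y_ opprD addrACA subrr add0r -scalerBr normrZ.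
  rewrite gtr0_norm// mulrC -ltr_pdivlMr// -/r.
  have : ball (v l) r (T_ n x).
    apply: contrapT => nb; apply: nV; rewrite /V -bigcup_seq.
    by exists l => //=; rewrite mem_index_enum.
  by rewrite mx_norm_ball /ball_/= Tx.
have e20 : 0 <= e / 2 by rewrite divr_ge0// ltW.
apply: le_trans (integral_dist_le finmu mfY (mfY_ n) (fun x => fM _)
  (fun x => fM _) mWV e20 close) _.
have -> : fmeas mu setT = 1 by rewrite /fmeas lebesgue_onE setIT Omega1.
have : M *+ 2 * fmeas mu (W `|` V) <= M *+ 2 * eta by rewrite ler_wpM2l// mulrn_wge0.
have : M *+ 2 * eta <= e / 2.
  have -> : e / 2 = (M + 1) *+ 2 * eta.
    by rewrite /eta mulr2n; field; rewrite gt_eqF// ltr_wpDl.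
  by apply: ler_wpM2r; [exact: ltW|rewrite lerMn2r lerDl ler01 orbT].
lra.
Qed.
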